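(* Let $\nu$ be a Borel probability measure on $\operatorname{Diff}^{1+\tau}(\mathbb{S}^1)$ (some $\tau>0$) satisfying $$\int\log\sup_{x\in\mathbb{S}^1}|f'(x)|\,d\nu(f)<\infty\quad\text{and}\quad\int\log\inf_{x\in\mathbb{S}^1}|f'(x)|\,d\nu(f)>-\infty.$$ Assume that $\Gamma_\nu$ is proximal and does not fix any point in $\mathbb{S}^1$. Let $\pi,\theta\colon X_\nu^{\mathbb{N}}\to\mathbb{S}^1$ be measurable maps such that for all $x\in\mathbb{S}^1$ and $\nu^{\mathbb{N}}$-almost every $\omega=(f_n)_{n\in\mathbb{N}}$, $\lim_{n}f_1\circ\cdots\circ f_n(x)=\pi(\omega)$ and $\lim_{n}f_1^{-1}\circ\cdots\circ f_n^{-1}(x)=\theta(\omega)$. Then for $\nu^{\mathbb{N}}$-almost every $\omega=(f_n)_{n\in\mathbb{N}}\in X_\nu^{\mathbb{N}}$ and every $x\in\mathbb{S}^1$, $$\lim_{n\to\infty}\frac1n\log|(f_n^{-1}\circ\cdots\circ f_1^{-1})'(x)|=\begin{cases}-\Lambda(\nu),&x\ne\pi(\omega),\\-\lambda(\nu),&x=\pi(\omega),\end{cases}$$ and $$\lim_{n\to\infty}\frac1n\log|(f_n\circ\cdots\circ f_1)'(x)|=\begin{cases}\lambda(\nu),&x\ne\theta(\omega),\\\Lambda(\nu),&x=\theta(\omega).\end{cases}$$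
   Context: $\mathbb{S}^1=\mathbb{R}/\mathbb{Z}$ with usual metric $d$. $\operatorname{Diff}^{1+\tau}(\mathbb{S}^1)$ is the group of $C^1$ diffeomorphisms of $\mathbb{S}^1$ (orientation preserving or reversing) whose derivative is $\tau$-Hölder. $X_\nu$ is the topological support of $\nu$, $\Gamma_\nu$ the semigroup generated by $X_\nu$. $\Gamma_\nu$ is proximal if for all $x,y\in\mathbb{S}^1$ there is a sequence $(g_n)$ in $\Gamma_\nu$ with $d(g_n(x),g_n(y))\to0$; it does not fix any point if no $x$ satisfies $f(x)=x$ for all $f\in\Gamma_\nu$. $\nu^{\mathbb{N}}$ is the product measure on $X_\nu^{\mathbb{N}}$. For $\omega=(f_n)_{n\in\mathbb{N}}$ write $f^n_\omega=f_n\circ\cdots\circ f_1$. The extremal Lyapunov exponents are the $\nu^{\mathbb{N}}$-almost sure limits (which exist and are constant by Kingman's subadditive ergodic theorem) $\Lambda(\nu)=\lim_n\frac1n\log\sup_{z}|(f^n_\omega)'(z)|$ and $\lambda(\nu)=\lim_n\frac1n\log\inf_z|(f^n_\omega)'(z)|$. *)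

(* Defs.v *)
From HB Require Import structures.
From mathcomp Require Import all_boot all_order all_algebra.
From mathcomp Require Import all_classical all_reals all_analysis.

Set Implicit Arguments.
Unset Strict Implicit.
Unset Printing Implicit Defensive.

Import Order.TTheory GRing.Theory Num.Theory.
Import numFieldNormedType.Exports.

Local Open Scope classical_set_scope.
Local Open Scope ring_scope.

(* The circle S^1 = R/Z.  Points of S^1 are represented by reals; two   *)
(* reals denote the same point iff they differ by an integer.  The      *)
(* canonical representative of a point is its fractional part in [0,1). *)

Definition frac {R : realType} (x : R) : R := x - (Num.floor x)%:~R.

Definition cdist {R : realType} (x y : R) : R :=
  Num.min (frac (x - y)) (1 - frac (x - y)).

Definition in_circle {R : realType} (x : R) : Prop := 0 <= x < 1.

(* Diff^{1+tau}(S^1): C^1 diffeomorphisms of S^1 (orientation preserving *)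
(* or reversing) whose derivative is tau-Hoelder.  A diffeomorphism f is *)
(* represented by its unique dlift F : R -> R normalised by F 0 in [0,1) *)
(* (f (x mod 1) = F x mod 1).  F is C^1 with nowhere vanishing derivative *)
(* and F (x+1) = F x + 1 (orientation preserving) or F (x+1) = F x - 1   *)
(* (orientation reversing); |f'(x)| = |F'(x)|.                          *)

Definition is_diff_lift {R : realType} (tau : R) (F : R -> R) : Prop :=
  [/\ (forall x, derivable F x 1),
      (forall x, derive1 F x != 0),
      (exists C : R, forall x y, `|derive1 F x - derive1 F y| <= C * (`|x - y| `^ tau)),
      ((forall x, F (x + 1) = F x + 1) \/ (forall x, F (x + 1) = F x - 1))
    & in_circle (F 0)].

Record cdiff (R : realType) (tau : R) := Diff {
  dlift : R -> R ;
  liftP : is_diff_lift tau dlift }.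

Lemma id_is_diff_lift (R : realType) (tau : R) : is_diff_lift tau id.
Proof.
split.
- by move=> x; exact: derivable_id.
- by move=> x; rewrite [derive1 _ _]derive1_id oner_neq0.
- by exists 0 => x y; rewrite !derive1_id subrr normr0 mul0r.
- by left.
- by rewrite /in_circle lexx ltr01.
Qed.

Definition diff_id (R : realType) (tau : R) : cdiff tau :=
  @Diff R tau id (id_is_diff_lift tau).

HB.instance Definition _ (R : realType) (tau : R) := gen_eqMixin (cdiff tau).
HB.instance Definition _ (R : realType) (tau : R) := gen_choiceMixin (cdiff tau).
HB.instance Definition _ (R : realType) (tau : R) :=
  isPointed.Build (cdiff tau) (diff_id tau).

Definition cmap {R : realType} {tau : R} (f : cdiff tau) (x : R) : R :=
  frac (dlift f x).

Definition c1dist {R : realType} {tau : R} (f g : cdiff tau) : R :=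
  sup [set cdist (dlift f x) (dlift g x) | x in [set: R]] +
  sup [set `|derive1 (dlift f) x - derive1 (dlift g) x| | x in [set: R]].

Definition c1ball {R : realType} {tau : R} (f : cdiff tau) (e : R) : set (cdiff tau) :=
  [set g | c1dist f g < e].

Definition c1open {R : realType} {tau : R} : set (set (cdiff tau)) :=
  [set U | forall f, U f -> exists2 e : R, 0 < e & c1ball f e `<=` U].

Definition Diff1t (R : realType) (tau : R) := g_sigma_algebraType (@c1open R tau).

Definition seq_gens (R : realType) (tau : R) : set (set (nat -> Diff1t tau)) :=
  \bigcup_(n in [set: nat])
     preimage_set_system setT (fun w : nat -> Diff1t tau => w n) measurable.

Definition DiffN (R : realType) (tau : R) := g_sigma_algebraType (@seq_gens R tau).

Definition is_product_measure (R : realType) (tau : R)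
    (nu : probability (Diff1t tau) R) (P : probability (DiffN tau) R) : Prop :=
  forall (n : nat) (A : nat -> set (Diff1t tau)),
    (forall i, measurable (A i)) ->
    P [set w : DiffN tau | forall i, (i < n)%N -> A i (w i)] =
      (\prod_(i < n) fine (nu (A i)))%:E.

Definition nu_support (R : realType) (tau : R) (nu : probability (Diff1t tau) R) :
    set (Diff1t tau) :=
  [set f | forall e : R, 0 < e -> (0 < nu (c1ball f e))%E].

Inductive in_semigroup (R : realType) (tau : R) (X : set (cdiff tau)) :
    (R -> R) -> Prop :=
| sg_gen f : X f -> in_semigroup X (cmap f)
| sg_comp f g : X f -> in_semigroup X g -> in_semigroup X (cmap f \o g).

Definition proximal (R : realType) (tau : R) (X : set (cdiff tau)) : Prop :=
  forall x y : R, in_circle x -> in_circle y ->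
    exists g : nat -> (R -> R), (forall n, in_semigroup X (g n)) /\
      (fun n => cdist (g n x) (g n y)) @ \oo --> 0.

Definition fixes_no_point (R : realType) (tau : R) (X : set (cdiff tau)) : Prop :=
  ~ exists x : R, in_circle x /\ forall g, in_semigroup X g -> g x = x.

(* inverse of a dlift (a bijection R -> R) *)
Definition finv {R : realType} (F : R -> R) (y : R) : R :=
  xget 0 [set x | F x = y].

(* lifts of compositions along w = (f_1, f_2, ...), with w i = f_(i+1) *)
Fixpoint fwd {R : realType} {tau : R} (w : nat -> cdiff tau) (n : nat) : R -> R :=
  match n with 0 => id | m.+1 => dlift (w m) \o fwd w m end.
Fixpoint bwd {R : realType} {tau : R} (w : nat -> cdiff tau) (n : nat) : R -> R :=
  match n with 0 => id | m.+1 => bwd w m \o dlift (w m) end.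
Fixpoint fwd_inv {R : realType} {tau : R} (w : nat -> cdiff tau) (n : nat) : R -> R :=
  match n with 0 => id | m.+1 => finv (dlift (w m)) \o fwd_inv w m end.
Fixpoint bwd_inv {R : realType} {tau : R} (w : nat -> cdiff tau) (n : nat) : R -> R :=
  match n with 0 => id | m.+1 => bwd_inv w m \o finv (dlift (w m)) end.

Definition supder {R : realType} (F : R -> R) : R := sup [set `|derive1 F z| | z in [set: R]].
Definition infder {R : realType} (F : R -> R) : R := inf [set `|derive1 F z| | z in [set: R]].

(* Main.v *)
Require Import Defs.
From HB Require Import structures.
From mathcomp Require Import all_boot all_order all_algebra.
From mathcomp Require Import all_classical all_reals all_analysis.
From mathcomp Require Import measurable_realfun ring lra.
Set Implicit Arguments.
Unset Strict Implicit.
Unset Printing Implicit Defensive.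
Import Order.TTheory GRing.Theory Num.Theory.
Import numFieldNormedType.Exports.
Local Open Scope classical_set_scope.
Local Open Scope ring_scope.

(** Write [S_n(w, x) = log |(f_n ... f_1)'(x)|]. Convergence of [f_1^-1 ... f_n^-1] to
    [theta w] on a finite grid forces [f_n ... f_1] to contract every compact arc
    avoiding [theta w]; averaging the moduli of continuity of [log |f_k'|] shows that
    [S_n(w, x) - S_n(w, y) = o(n)] for [x, y] different from [theta w], and that
    [S_n(w, x) <= o(n)] there. A Katznelson-Weiss covering argument over the ergodic shift
    produces, for every [q] below the top exponent [Lp = lim E (sup S_n) / n], some point [x]
    with [S_n(w, x) >= n q - C], and symmetrically points of growth rate at most [q] for
    every [q] above the bottom exponent [Lm]. Since all points other than [theta w] share
    one growth rate, [theta w] must carry one of the two exponents and the other points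
    the other one. The wrong assignment is impossible: a negative exponent at [theta w]
    would contract a neighbourhood of [theta w], whose points would inherit it, while a
    positive exponent elsewhere contradicts the contraction.

    The statement on inverses is the same one for the walk [f_n^-1 ... f_1^-1], whose
    repelling point is [pi w]: [f_n^-1 ... f_1^-1] is inverse to [f_1 ... f_n], which has
    the law of [f_n ... f_1], so the exponents of the inverse walk are [-Lm] and [-Lp]. *)

(** * Lifts of circle diffeomorphisms *)

(** The limits are claimed for almost every [w] and for all [x] at once, so facts that hold almost
    surely for each fixed [x] do not suffice. Probability therefore enters only through countably
    many almost sure facts, mostly one-sided bounds [n q + C] with [C] depending on [w], and the
    passage to every [x] is deterministic. The point of nearly extremal growth depends on [w], so
    the covering argument runs over the skew product of the shift with the line; it integrates over
    [w] alone, after bounding the cocycle uniformly in the starting point. Openness in the starting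
    point reduces it to rationals, which keeps the sets measurable, and compactness of the circle
    turns points that are good up to each finite time into one good for all times. Signs matter:
    each lift has a point where [|F'| = 1], so [Lm <= 0 <= Lp], and this settles the two cases in
    which the exponents could be exchanged. *)

Section circle_lifts.
Context {R : realType}.
Implicit Types (F G : R -> R) (x y z : R).

(** Composition and inversion preserve these four conditions but not the normalisation of [F 0], so
    all walks and their inverses stay in this class. *)
Definition c1_lift F : Prop :=
  [/\ forall x, derivable F x 1, continuous (derive1 F),
      forall x, derive1 F x != 0 &
      (forall x, F (x + 1) = F x + 1) \/ (forall x, F (x + 1) = F x - 1)].

Definition logd F x : R := ln `|derive1 F x|.

Lemma c1_lift_continuous F : c1_lift F -> continuous F.
Proof.
by move=> [dF _ _ _] x; apply/differentiable_continuous/derivable1_diffP/dF.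
Qed.

Lemma c1_lift_MVT F x y : c1_lift F -> x <= y ->
  exists2 c, x <= c <= y & F y - F x = derive1 F c * (y - x).
Proof.
move=> hF xy; have [dF _ _ _] := hF.
have [||c] := @MVT_segment R F (derive1 F) x y xy.
  by move=> c _; rewrite derive1E; exact/derivableP/dF.
- by apply/continuous_subspaceT/c1_lift_continuous.
- by rewrite in_itv /= => h1 h2; exists c.
Qed.

Lemma expR_logd F x : c1_lift F -> expR (logd F x) = `|derive1 F x|.
Proof. by move=> [_ _ nF _]; rewrite /logd lnK// posrE normr_gt0. Qed.

Lemma c1_lift_dist F x y : c1_lift F -> exists c,
  [/\ Num.min x y <= c, c <= Num.max x y &
      `|F y - F x| = expR (logd F c) * `|y - x|].
Proof.
move=> hF; have [xy|/ltW yx] := leP x y.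
  have [c /andP[xc cy] E] := c1_lift_MVT hF xy.
  by exists c; split=> //; rewrite E expR_logd// normrM.
have [c /andP[xc cy] E] := c1_lift_MVT hF yx.
by exists c; split=> //; rewrite distrC E expR_logd// normrM (distrC y).
Qed.

Lemma c1_lift_inj F : c1_lift F -> injective F.
Proof.
move=> hF x y Fxy; have [c [_ _]] := c1_lift_dist x y hF.
rewrite Fxy subrr normr0 => /esym/eqP; rewrite mulf_eq0 expR_eq0/=.
by rewrite normr_eq0 subr_eq0 => /eqP.
Qed.

Lemma mulrr_eq1 (e : R) : e * e = 1 -> e = 1 \/ e = -1.
Proof. by move/eqP; rewrite -expr2 sqrf_eq1 => /orP[]/eqP; [left|right]. Qed.

(** [e] is the degree of the circle map; kept as a real number of square 1, it serves both
    orientations at once. *)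
Lemma c1_lift_deg F : c1_lift F ->
  exists2 e : R, e * e = 1 &
    forall x (z : int), F (x + z%:~R) = F x + e * z%:~R.
Proof.
move=> [_ _ _ h].
have [e ee he] : exists2 e : R, e * e = 1 & forall x, F (x + 1) = F x + e.
  by case: h => h; [exists 1|exists (-1)] => //; rewrite ?mulr1// mulrNN mulr1.
exists e => // x z.
have hn (n : nat) y : F (y + n%:R) = F y + e * n%:R.
  elim: n => [|n IH]; first by rewrite mulr0 !addr0.
  by rewrite -natr1 addrA he IH mulrDr mulr1 addrA.
case: z => n; first exact: hn.
have := hn n.+1 (x + (Negz n)%:~R); rewrite NegzE mulrNz -!pmulrn addrNK.
by move=> ->; rewrite mulrN addrK.
Qed.

(** By the degree formula the values at [n] and [- n] are [F 0 + e n] and [F 0 - e n]; for large [n]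
    they enclose [y]. *)
Lemma c1_lift_surj F y : c1_lift F -> exists x, F x = y.
Proof.
move=> hF; have [e ee he] := c1_lift_deg hF.
have [n hn] : exists n : nat, `|y - F 0| <= n%:R.
  exists (Num.truncn `|y - F 0|).+1; exact/ltW/truncnS_gt.
have Fn := he 0 (Posz n); have Fm := he 0 (- Posz n).
rewrite add0r mulrNz mulrN -pmulrn in Fm; rewrite add0r -pmulrn in Fn.
have [|||c _ <-] := @IVT R F (- n%:R) n%:R y; last by exists c.
- by rewrite ge0_cp.
- by apply/continuous_subspaceT/c1_lift_continuous.
rewrite Fn Fm; move: hn; rewrite ler_norml => /andP[h1 h2].
have [->|->] := mulrr_eq1 ee.
- rewrite mul1r; rewrite ge_min le_max; apply/andP; split; apply/orP; lra.
- rewrite mulN1r; rewrite ge_min le_max; apply/andP; split; apply/orP; lra.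
Qed.

Lemma finvK F : c1_lift F -> cancel (Defs.finv F) F.
Proof.
move=> hF y; rewrite /Defs.finv; have [x xy] := c1_lift_surj y hF.
by case: xgetP => [x' _ //|/(_ x)]; rewrite /= xy.
Qed.

Lemma Kfinv F : c1_lift F -> cancel F (Defs.finv F).
Proof. by move=> hF x; apply: (c1_lift_inj hF); rewrite finvK. Qed.

Lemma c1_lift_sign F : c1_lift F ->
  (forall x, 0 < derive1 F x) \/ (forall x, derive1 F x < 0).
Proof.
move=> [_ cF nF _].
have aux x y : 0 < derive1 F x -> derive1 F y < 0 -> False.
  move=> hx hy.
  have [|||c _ /eqP] := @IVT R (derive1 F) (Num.min x y) (Num.max x y) 0; last first.
    exact/negP.
  - by case: (leP x y) => _; rewrite ge_min le_max (ltW hx) (ltW hy) ?orbT.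
- exact/continuous_subspaceT.
- by case: (leP x y) => // /ltW.
have [h|h] := ltP 0 (derive1 F 0); [left|right] => x.
  have [//|hx] := ltP 0 (derive1 F x).
  by exfalso; apply: (aux 0 x); rewrite // lt_neqAle nF.
have [//|hx] := ltP (derive1 F x) 0.
by exfalso; apply: (aux x 0); rewrite // lt_neqAle ?nF// eq_sym nF.
Qed.

Lemma logd_comp F G x : c1_lift F -> c1_lift G ->
  logd (F \o G) x = logd F (G x) + logd G x.
Proof.
move=> [dF _ nF _] [dG _ nG _]; rewrite /logd derive1_comp//.
by rewrite normrM lnM// posrE normr_gt0.
Qed.

Lemma c1_lift_id : c1_lift (@id R).
Proof.
split=> [x|x|x|]; rewrite ?derive1_id ?oner_neq0//; last by left.
have -> : derive1 (@id R) = cst 1 by apply/funext => y; rewrite derive1_id.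
exact: cst_continuous.
Qed.

Lemma c1_lift_comp F G : c1_lift F -> c1_lift G -> c1_lift (F \o G).
Proof.
move=> hF hG; have [dF cF nF pF] := hF; have [dG cG nG pG] := hG.
have E : derive1 (F \o G) = (fun x => derive1 F (G x) * derive1 G x).
  by apply/funext => x; rewrite derive1_comp.
split.
- move=> x; apply/derivable1_diffP/differentiable_comp;
  exact/derivable1_diffP.
- rewrite E => x; apply: (@continuousM _ _ (fun x => derive1 F (G x)) (derive1 G)); last exact: cG.
  apply: (@continuous_comp _ _ _ G (derive1 F)); [exact: c1_lift_continuous|exact: cF].
- by move=> x; rewrite E mulf_neq0.
- have H : forall x, F (x - 1) = F x - 1 \/ F (x - 1) = F x + 1.
    move=> x; case: pF => /(_ (x - 1)); rewrite subrK => ->; [left|right]; lra.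
  case: pF; case: pG => hg hf; [left|right|right|left] => x /=;
    rewrite hg ?hf//; have := hf (G x - 1); rewrite subrK => ->; lra.
Qed.

Lemma derive1_finv F y : c1_lift F ->
  is_derive y 1 (Defs.finv F) (derive1 F (Defs.finv F y))^-1.
Proof.
move=> hF; rewrite -{1}(finvK hF y).
apply: is_derive_inverse.
- by apply: (@filterE _ (nbhs (Defs.finv F y))) => x; exact: Kfinv.
- by apply: (@filterE _ (nbhs (Defs.finv F y))) => x; exact: c1_lift_continuous.
- by rewrite derive1E; apply/derivableP; case: hF.
- by case: hF.
Qed.

Lemma derive1_finvE F y : c1_lift F ->
  derive1 (Defs.finv F) y = (derive1 F (Defs.finv F y))^-1.
Proof. by move=> hF; rewrite derive1E; have /@derive_val := derive1_finv y hF. Qed.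

Lemma logd_finv F y : c1_lift F -> logd (Defs.finv F) y = - logd F (Defs.finv F y).
Proof.
move=> hF; rewrite /logd derive1_finvE// normfV lnV// posrE normr_gt0.
by case: hF.
Qed.

Lemma c1_lift_finv F : c1_lift F -> c1_lift (Defs.finv F).
Proof.
move=> hF; have [e ee he] := c1_lift_deg hF; have [_ cF nF _] := hF.
have dF y : derivable (Defs.finv F) y 1 by have /@ex_derive := derive1_finv y hF.
have E : derive1 (Defs.finv F) = (fun y => (derive1 F (Defs.finv F y))^-1).
  by apply/funext => y; exact: derive1_finvE.
split; [exact: dF| | |].
- rewrite E => y; apply: (@continuousV _ _ (fun y => derive1 F (Defs.finv F y))); first exact: nF.
  apply: (@continuous_comp _ _ _ (Defs.finv F) (derive1 F)); last exact: cF.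
  exact/differentiable_continuous/derivable1_diffP.
- by move=> x; rewrite E invr_neq0.
have [E1|E1] := mulrr_eq1 ee.
- left => y; apply: (c1_lift_inj hF); have := he (Defs.finv F y) 1%Z.
  by rewrite [in RHS]finvK// E1 mul1r => ->; rewrite finvK.
- right => y; apply: (c1_lift_inj hF); have := he (Defs.finv F y) (-1)%Z.
  by rewrite [in RHS]finvK// E1 mulrN1z mulrNN mul1r => ->; rewrite finvK.
Qed.

Lemma logd_int F x (z : int) : c1_lift F -> logd F (x + z%:~R) = logd F x.
Proof.
move=> hF; have [e _ he] := c1_lift_deg hF.
rewrite /logd; suff -> : derive1 F (x + z%:~R) = derive1 F x by [].
have E : (fun h : R => h^-1 *: (F (h + (x + z%:~R)) - F (x + z%:~R))) =
         (fun h : R => h^-1 *: (F (h + x) - F x)).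
  by apply/funext => h; rewrite addrA !he opprD addrACA subrr addr0.
by rewrite /derive1 E.
Qed.

Lemma logd_continuous F : c1_lift F -> continuous (logd F).
Proof.
move=> [_ cF nF _] x; apply: (@continuous_comp _ _ _ (fun x => `|derive1 F x|) (@ln R)).
  apply: (@continuous_comp _ _ _ (derive1 F) (fun y : R => `|y|)); [exact: cF|exact: norm_continuous].
by apply: continuous_ln; rewrite normr_gt0.
Qed.

Lemma logd_bounded F : c1_lift F -> exists C : R, forall x, `|logd F x| <= C.
Proof.
move=> hF.
have c : {within `[0, 1], continuous (fun x => `|logd F x|)}.
  apply: continuous_subspaceT => x.
  apply: (@continuous_comp _ _ _ (logd F) (fun y : R => `|y|)); last exact: norm_continuous.
  exact: logd_continuous.
have [c0 _ hc] := EVT_max ler01 c.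
exists `|logd F c0| => x; clear c.
have := logd_int x (- Num.floor x) hF; rewrite mulrNz => <-; apply: hc.
have /andP[h1 h2] := floor_itv x; rewrite intrD in h2.
by rewrite in_itv /= subr_ge0 h1 lerBlDl ltW.
Qed.

(** Over one period [F] moves by exactly 1, and the mean value theorem applies. Hence [log sup |F'|]
    and [- log inf |F'|] are both nonnegative. *)
Lemma logd_root F : c1_lift F -> exists x, logd F x = 0.
Proof.
move=> hF; have [c [_ _]] := c1_lift_dist 0 1 hF.
rewrite -{1}(add0r 1); have [e ee /(_ 0 1%Z) ->] := c1_lift_deg hF.
rewrite mulr1 addrC addKr subr0 normr1 mulr1 => h; exists c.
have -> : logd F c = ln (expR (logd F c)) by rewrite expRK.
by rewrite -h; have /eqP := ee; rewrite -expr2 sqrf_eq1 => /orP[]/eqP->;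
  rewrite ?normrN normr1 ln1.
Qed.

End circle_lifts.

(** * Growth rates along a sequence contracting off one point *)

Section walks.
Context {R : realType}.
Implicit Types (g h : nat -> R -> R) (x y z : R).

Fixpoint walk g n : R -> R := if n is m.+1 then g m \o walk g m else id.
Fixpoint rwalk h n : R -> R := if n is m.+1 then rwalk h m \o h m else id.

Lemma c1_lift_walk g n : (forall k, c1_lift (g k)) -> c1_lift (walk g n).
Proof. by move=> hg; elim: n => [|n IH]; [exact: c1_lift_id|exact: c1_lift_comp]. Qed.

Lemma c1_lift_rwalk g n : (forall k, c1_lift (g k)) -> c1_lift (rwalk g n).
Proof. by move=> hg; elim: n => [|n IH]; [exact: c1_lift_id|exact: c1_lift_comp]. Qed.

Lemma walkK g h n : (forall k, cancel (g k) (h k)) -> cancel (walk g n) (rwalk h n).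
Proof. by move=> hgh; elim: n => [//|n IH] x /=; rewrite hgh IH. Qed.

Lemma logd_walkS g n x : (forall k, c1_lift (g k)) ->
  logd (walk g n.+1) x = logd (g n) (walk g n x) + logd (walk g n) x.
Proof. by move=> hg /=; rewrite logd_comp//; exact: c1_lift_walk. Qed.

Lemma logd_id x : logd (@id R) x = 0.
Proof. by rewrite /logd derive1_id normr1 ln1. Qed.

Lemma frac_itv x : 0 <= Defs.frac x < 1.
Proof.
have /andP[h1 h2] := floor_itv x; rewrite intrD in h2.
by rewrite /Defs.frac subr_ge0 h1 ltrBlDl.
Qed.

Lemma cdist_int x y r : cdist x y < r -> exists z : int, `|x - y - z%:~R| < r.
Proof.
have /andP[h1 h2] := frac_itv (x - y); rewrite /cdist gt_min => /orP[h|h].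
  by exists (Num.floor (x - y)); rewrite ger0_norm.
exists (Num.floor (x - y) + 1); rewrite intrD opprD addrA -/(Defs.frac _).
by rewrite distrC ger0_norm// subr_ge0 ltW.
Qed.

(* The circle minus a small neighbourhood of [theta] is an arc whose image under
   [walk g n] misses the grid [i/(m+1)], since the preimages of the grid points are
   all near [theta]; hence the image lies in a single gap of the grid. *)
Lemma walk_contract g h theta a b (m : nat) :
  (forall k, c1_lift (g k)) -> (forall k, c1_lift (h k)) ->
  (forall k, cancel (g k) (h k)) -> (forall k, cancel (h k) (g k)) ->
  (forall i : 'I_m.+1,
     (fun n => cdist (rwalk h n (i%:R / m.+1%:R)) theta) @ \oo --> (0 : R)) ->
  theta < a -> a <= b -> b < theta + 1 ->
  exists N, forall n x y, (N <= n)%N -> a <= x <= b -> a <= y <= b ->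
    `|walk g n x - walk g n y| <= m.+1%:R^-1.
Proof.
move=> hg hh gK hK hth ta ab bt.
have m0 : (0 : R) < m.+1%:R by rewrite ltr0n.
(* Every point of [[a, b]] lies at distance at least [r] from every integer translate of [theta]. *)
pose r := Num.min (a - theta) (theta + 1 - b).
have r0 : 0 < r by rewrite /r lt_min !subr_gt0 ta.
have r1 : r <= a - theta by rewrite /r ge_min lexx.
have r2 : r <= theta + 1 - b by rewrite /r ge_min lexx orbT.
have : \forall n \near \oo, forall i : 'I_m.+1,
    cdist (rwalk h n (i%:R / m.+1%:R)) theta < r.
  apply: filter_forall => i; have /cvgrPdist_lt/(_ _ r0) := hth i.
  apply: filterS => n; rewrite sub0r normrN; exact: le_lt_trans (ler_norm _).
move=> [N _ hN]; exists N => n x y Nn.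
wlog: x y / walk g n y <= walk g n x.
  move=> W hx hy; have [h1|/ltW h1] := leP (walk g n y) (walk g n x).
    exact: W.
  by rewrite distrC; exact: W.
move=> yx hx hy; rewrite leNgt; apply/negP; rewrite ger0_norm ?subr_ge0// => gap.
(* The first grid point above [walk g n y]; a gap larger than the mesh places it below
   [walk g n x]. *)
pose j := Num.floor (walk g n y * m.+1%:R) + 1.
have /andP[j1 j2] := floor_itv (walk g n y * m.+1%:R).
have jy : walk g n y < j%:~R / m.+1%:R by rewrite ltr_pdivlMr.
have jx : j%:~R / m.+1%:R < walk g n x.
  rewrite ltr_pdivrMr// /j intrD.
  have : m.+1%:R^-1 * m.+1%:R < (walk g n x - walk g n y) * m.+1%:R by rewrite ltr_pM2r.
  by rewrite mulVf ?gt_eqF// mulrBl; lra.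
have cw := c1_lift_walk n hg.
have [c hc hcj] : exists2 c, a <= c <= b & walk g n c = j%:~R / m.+1%:R.
  have [|||c] := @IVT R (walk g n) (Num.min x y) (Num.max x y) (j%:~R / m.+1%:R).
  - by case: (leP x y) => // /ltW.
  - exact/continuous_subspaceT/c1_lift_continuous.
  - by case: (leP x y) => _; rewrite ge_min le_max (ltW jx) (ltW jy) ?orbT.
  rewrite in_itv /= => /andP[c1 c2] <-; exists c => //.
  move: hx hy => /andP[x1 x2] /andP[y1 y2].
  rewrite (le_trans _ c1) ?le_min ?x1//.
  by rewrite (le_trans c2)// ge_max x2.
(* Convergence is known only for grid points of [[0, 1)]: [j] is reduced modulo [m+1], which moves
   its preimage [c] by an integer. *)
have hi : (`|(j %% m.+1%:Z)%Z| < m.+1)%N.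
  by rewrite -ltz_nat gez0_abs ?modz_ge0// ltz_pmod.
have := hN n Nn (Ordinal hi) => /= /cdist_int[z].
have hm : j%:~R = (`|(j %% m.+1%:Z)%Z|%N)%:R + (j %/ m.+1%:Z)%Z%:~R * m.+1%:R :> R.
  by rewrite natr_absz ger0_norm ?modz_ge0// {1}(divz_eq j m.+1%:Z) intrD intrM addrC.
have [e ee he] := c1_lift_deg (c1_lift_rwalk n hh).
have -> : rwalk h n ((`|(j %% m.+1%:Z)%Z|%N)%:R / m.+1%:R) = c - e * (j %/ m.+1%:Z)%Z%:~R.
  rewrite -(walkK (h:=h) n gK c) hcj hm mulrDl mulfK ?gt_eqF// he; lra.
have [e' ->] : exists e' : int, e = e'%:~R.
  by have [->|->] := mulrr_eq1 ee; [exists 1|exists (-1)].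
rewrite -intrM; set k := (_ * _)%R => hz.
have {}hz : `|c - theta - (k + z)%:~R| < r.
  apply: le_lt_trans hz; rewrite intrD.
  by have -> : c - theta - (k%:~R + z%:~R) = c - k%:~R - theta - z%:~R by lra.
move: hz hc; rewrite ltr_norml => /andP[z1 z2] /andP[c1 c2].
have [kz|kz] := leP (k + z) 0.
  have : (k + z)%:~R <= (0 : R) by rewrite lerz0.
  lra.
have : (1 : R) <= (k + z)%:~R by rewrite ler1z.
lra.
Qed.

End walks.

(** * Exponents along one fixed sequence of maps *)

Section dichotomy.
Context {R : realType}.
Variables (g : nat -> R -> R) (theta : R).
Implicit Types x y z : R.
Hypothesis hg : forall k, c1_lift (g k).
Hypothesis hmod : forall e : R, 0 < e -> exists d : R, 0 < d /\ exists mu : nat -> R,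
  (forall i x y, `|x - y| < d -> `|logd (g i) x - logd (g i) y| <= mu i) /\
  exists C : R, forall n, \sum_(i < n) mu i <= n%:R * e + C.
Hypothesis hcon : forall a b : R, theta < a -> a <= b -> b < theta + 1 ->
  forall d : R, 0 < d -> exists N, forall n x y, (N <= n)%N ->
    a <= x <= b -> a <= y <= b -> `|walk g n x - walk g n y| < d.

Let S n x := logd (walk g n) x.
Let off x := forall z : int, x <> theta + z%:~R.

(** By the chain rule the difference is a sum over time of differences of [logd (g k)] along the two
    orbits. Each costs at most [mu k] while the orbits are [d]-close; the first [N] times cost a
    bounded amount, absorbed in [C]. The order of quantifiers matters: contraction provides [N] only
    once [d] is given. *)
Lemma shadowing (e : R) : 0 < e -> exists2 d : R, 0 < d &
  forall N, exists C : R, forall n x y,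
    (forall k, (N <= k < n)%N -> `|walk g k x - walk g k y| < d) ->
    `|S n x - S n y| <= n%:R * e + C.
Proof.
move=> e0; have [d [d0 [mu [hmu [C hC]]]]] := hmod e0.
exists d => // N.
have /choice[B hB] : forall k, exists b : R, forall x, `|logd (g k) x| <= b.
  by move=> k; exact: logd_bounded.
have B0 k : 0 <= 2 * B k by rewrite mulr_ge0// (le_trans _ (hB k 0)).
have mu0 k : 0 <= mu k by have := hmu k 0 0; rewrite !subrr normr0; apply.
(* Worst cost of the first [m] times, when the orbits may be far apart. *)
pose K m := \sum_(0 <= i < m) 2 * B i.
exists (C + K N) => n x y hxy.
suff H : `|S n x - S n y| <= \sum_(i < n) mu i + K (minn n N).
  apply: (le_trans H); rewrite addrA lerD//.
  rewrite /K [leRHS](@big_cat_nat _ _ _ (minn n N))//= ?geq_minr//.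
  by rewrite lerDl sumr_ge0.
elim: n hxy => [_|n IH hxy].
  rewrite (_ : S 0 x - S 0 y = 0) ?normr0 ?big_ord0; last by rewrite /S /= !logd_id subrr.
  by rewrite /K min0n big_geq// addr0.
have {}IH : `|S n x - S n y| <= \sum_(i < n) mu i + K (minn n N).
  by apply: IH => k /andP[Nk kn]; rewrite hxy// Nk ltnW.
rewrite /S !logd_walkS// big_ord_recr/=.
have -> : forall a b c d : R, a + b - (c + d) = (a - c) + (b - d) by move=> *; lra.
apply: (le_trans (ler_normD _ _)).
have [nN|Nn] := ltnP n N.
  have E : minn n.+1 N = (minn n N).+1 by rewrite !(minn_idPl _)// ltnW.
  have {}E : K (minn n.+1 N) = K (minn n N) + 2 * B n.
    rewrite E /K big_nat_recr//=; congr (_ + 2 * B _); apply/minn_idPl; exact: ltnW.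
  rewrite E.
  have : `|logd (g n) (walk g n x) - logd (g n) (walk g n y)| <= 2 * B n.
    apply: (le_trans (ler_normB _ _)); have := hB n (walk g n x); have := hB n (walk g n y); lra.
  by move: IH; rewrite /S; have := mu0 n; lra.
have -> : minn n.+1 N = minn n N by rewrite !(minn_idPr _)// leqW.
have : `|logd (g n) (walk g n x) - logd (g n) (walk g n y)| <= mu n.
  by apply: hmu; apply: hxy; rewrite Nn ltnSn.
by move: IH; rewrite /S; lra.
Qed.

Lemma walk_logd_int n x (z : int) : S n (x + z%:~R) = S n x.
Proof. by rewrite /S logd_int//; exact: c1_lift_walk. Qed.

Lemma off_repr x : off x -> exists z : int, theta < x + z%:~R < theta + 1.
Proof.
move=> hx; exists (- Num.floor (x - theta)).
have /andP[h1 h2] := frac_itv (x - theta).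
have hf : Defs.frac (x - theta) = x - theta - (Num.floor (x - theta))%:~R by [].
rewrite mulrNz; apply/andP; split; last by lra.
rewrite lt_neqAle; apply/andP; split; last lra.
apply/eqP => E; apply: (hx (Num.floor (x - theta))); lra.
Qed.

(** Integer translates of the two points lie in one compact arc of [(theta, theta + 1)], which the
    walk contracts, so shadowing applies from some time on. *)
Lemma off_indep x y (e : R) : off x -> off y -> 0 < e ->
  exists C : R, forall n, `|S n x - S n y| <= n%:R * e + C.
Proof.
move=> /off_repr[k /andP[x1 x2]] /off_repr[l /andP[y1 y2]] e0.
have [d d0 hd] := shadowing e0.
have [|||N hN] := @hcon (Num.min (x + k%:~R) (y + l%:~R)) (Num.max (x + k%:~R) (y + l%:~R)) _ _ _ d d0.
- by rewrite lt_min x1.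
- by rewrite ge_min !le_max lexx.
- by rewrite gt_max x2.
have [C hC] := hd N; exists C => n.
rewrite -(walk_logd_int n x k) -(walk_logd_int n y l).
apply: hC => j /andP[Nj _]; apply: hN => //;
  by rewrite ge_min le_max lexx ?orbT.
Qed.

(** The image of an arc starting at a translate of [x] eventually has length below 1, so the mean
    value theorem yields a point of the arc whose derivative is bounded independently of [n];
    shadowing transfers the bound to [x]. *)
Lemma off_nonexpanding x (e : R) : off x -> 0 < e -> exists C : R, forall n, S n x <= n%:R * e + C.
Proof.
move=> /off_repr[k /andP[x1 x2]] e0.
pose a := x + k%:~R; pose b := (a + (theta + 1)) / 2.
have ab : a < b by rewrite /b /a; lra.
have bt : b < theta + 1 by rewrite /b /a; lra.
have [d d0 hd] := shadowing e0.
have [N hN] := @hcon a b x1 (ltW ab) bt (Num.min 1 d) ltac:(by rewrite lt_min ltr01).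
have [C hC] := hd N.
exists (C + `|ln (b - a)| + \sum_(i < N) `|S i x| + `|C|) => n.
have sN : 0 <= \sum_(i < N) `|S i x| by rewrite sumr_ge0.
have ne : 0 <= n%:R * e by rewrite mulr_ge0// ltW.
have := ler_norm (- C); rewrite normrN => CC.
have lb := normr_ge0 (ln (b - a)).
have cc := normr_ge0 C.
have [nN|Nn] := ltnP n N.
  have : S n x <= \sum_(i < N) `|S i x|.
    rewrite (bigD1 (Ordinal nN))//= (le_trans (ler_norm _))// lerDl sumr_ge0//.
  lra.
have aab : a <= a <= b by rewrite lexx ltW.
have bab : a <= b <= b by rewrite lexx ltW.
have [c [c1 c2 hc]] := c1_lift_dist a b (c1_lift_walk n hg).
rewrite (min_l (ltW ab)) in c1; rewrite (max_r (ltW ab)) in c2.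
have hc1 : S n c <= - ln (b - a).
  rewrite -lnV ?posrE ?subr_gt0// -ler_expR lnK ?posrE ?invr_gt0 ?subr_gt0//.
  rewrite -[leRHS]mul1r ler_pdivlMr ?subr_gt0//.
  rewrite -[X in _ * X]gtr0_norm ?subr_gt0// -hc ltW//.
  by apply: (lt_le_trans (hN n b a Nn bab aab)); rewrite ge_min lexx.
have : `|S n a - S n c| <= n%:R * e + C.
  apply: hC => j /andP[Nj _]; apply: (lt_le_trans (hN j a c Nj aab _)).
    by rewrite c1.
  by rewrite ge_min lexx orbT.
rewrite {1}/a walk_logd_int => /(le_trans (ler_norm _)).
have := ler_norm (- ln (b - a)); rewrite normrN; lra.
Qed.

(* If [theta] had a negative exponent, a neighbourhood of it would be contracted
   along its orbit, and points of that neighbourhood would share its exponent. *)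
Lemma contracting_theta_off (c c' C : R) : c < c' -> c' < 0 ->
  (forall n, S n theta <= n%:R * c + C) ->
  exists x, off x /\ exists C' : R, forall n, S n x <= n%:R * c' + C'.
Proof.
move=> cc c0 hS; have e0 : 0 < c' - c by rewrite subr_gt0.
have [d d0 /(_ 0)[C1 hC1]] := shadowing e0.
pose K := `|C| + `|C1|.
(* The factor [expR (- K)] keeps images of the neighbourhood within [d / 2] as long as log
   derivatives are at most [K]; the bound 1/2 keeps [theta + r] off the translates of [theta]. *)
pose r := Num.min (d / 2 * expR (- K)) (1 / 2).
have r0 : 0 < r by rewrite /r lt_min mulr_gt0 ?expR_gt0 ?divr_gt0.
have r1 : r <= 1 / 2 by rewrite /r ge_min lexx orbT.
have r2 : r * expR K <= d / 2.
  by rewrite -ler_pdivlMr ?expR_gt0// -expRN /r ge_min lexx.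
have key y n : (forall k, (k < n)%N -> `|walk g k y - walk g k theta| < d) ->
    S n y <= n%:R * c' + (C + C1).
  move=> hy; have h1 : `|S n y - S n theta| <= n%:R * (c' - c) + C1 by apply: hC1 => k /hy.
  have := le_trans (ler_norm _) h1; have := hS n; lra.
(* Strong induction: closeness at all earlier times bounds the derivative at time [n] by [expR K],
   which in turn gives closeness at time [n]. *)
have H n : forall y, theta <= y <= theta + r -> `|walk g n y - walk g n theta| < d.
  elim/ltn_ind: n => n IH y /andP[y1 y2].
  have [xi [x1 x2 ->]] := c1_lift_dist theta y (c1_lift_walk n hg).
  rewrite (min_l y1) in x1; rewrite (max_r y1) in x2.
  have Sxi : S n xi <= K.
    apply: (le_trans (key xi n _)) => [k kn|].
      by apply: IH => //; rewrite x1 (le_trans x2).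
    have := ler_norm C; have := ler_norm C1; rewrite /K.
    have : n%:R * c' <= 0 by rewrite mulr_ge0_le0// ltW.
    lra.
  have yr : `|y - theta| <= r by rewrite ger0_norm ?subr_ge0//; lra.
  rewrite mulrC; apply: le_lt_trans (_ : d / 2 < d); last lra.
  apply: le_trans r2; apply: ler_pM => //; rewrite ?expR_ge0 ?ler_expR//.
exists (theta + r); split.
  move=> z /addrI E; have [z0|z0] := leP z 0.
    have : z%:~R <= (0 : R) by rewrite lerz0. lra.
  have : (1 : R) <= z%:~R by rewrite ler1z. lra.
exists (C + C1) => n; apply: key => k _; apply: H.
by rewrite lexx lerDl ltW.
Qed.

Lemma rate_conflict (u : nat -> R) (q q' C C' : R) : q' < q ->
  (forall n, n%:R * q - C <= u n) -> (forall n, u n <= n%:R * q' + C') -> False.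
Proof.
move=> qq h1 h2; pose n := (Num.truncn ((C + C') / (q - q'))).+1.
have : (C + C') / (q - q') < n%:R by exact: truncnS_gt.
rewrite ltr_pdivrMr ?subr_gt0//; have := h1 n; have := h2 n; lra.
Qed.

Lemma rate_cvg (u : nat -> R) (L : R) :
  (forall e : R, 0 < e -> exists C : R, forall n, n%:R * (L - e) - C <= u n) ->
  (forall e : R, 0 < e -> exists C : R, forall n, u n <= n%:R * (L + e) + C) ->
  (fun n => n%:R^-1 * u n) @ \oo --> L.
Proof.
move=> h1 h2; apply/cvgrPdist_le => e e0.
have e2 : 0 < e / 2 by rewrite divr_gt0.
have [C hC] := h1 _ e2; have [C' hC'] := h2 _ e2.
exists (Num.truncn ((`|C| + `|C'|) / (e / 2))).+1 => // n /= hn.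
have n0 : 0 < n%:R :> R by rewrite ltr0n; case: n hn.
have : (`|C| + `|C'|) / (e / 2) < n%:R.
  by apply: (lt_le_trans (truncnS_gt _)); rewrite ler_nat.
rewrite ltr_pdivrMr// => hn2.
have -> : L - n%:R^-1 * u n = n%:R^-1 * (n%:R * L - u n).
  by rewrite mulrBr mulKf// gt_eqF.
rewrite normrM gtr0_norm ?invr_gt0// ler_pdivrMl// ler_norml.
have := hC n; have := hC' n; have := ler_norm C; have := ler_norm C'.
have := normr_ge0 C; have := normr_ge0 C'.
by move=> *; apply/andP; split; lra.
Qed.

Variables Lm Lp : R.
Hypothesis Lm0 : Lm <= 0.
Hypothesis Lp0 : 0 <= Lp.
Hypothesis hup : forall e : R, 0 < e -> exists C : R, forall n x, S n x <= n%:R * (Lp + e) + C.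
Hypothesis hlo : forall e : R, 0 < e -> exists C : R, forall n x, n%:R * (Lm - e) - C <= S n x.
Hypothesis hxp : forall q : R, q < Lp -> exists (x C : R), forall n, n%:R * q - C <= S n x.
Hypothesis hxm : forall q : R, Lm < q -> exists (x C : R), forall n, S n x <= n%:R * q + C.

Lemma notoff x : ~ off x -> exists z : int, x = theta + z%:~R.
Proof. by rewrite /off -existsNP => -[z /contrapT]; exists z. Qed.

Lemma rate_weaken (q q' C : R) (u : nat -> R) : q' <= q ->
  (forall n, n%:R * q - C <= u n) -> (forall n, n%:R * q' - C <= u n).
Proof.
move=> qq h n; apply: le_trans (h n); rewrite lerD2r; exact: ler_wpM2l.
Qed.

Lemma off_rate x y (q q' C : R) : off x -> off y -> q' < q ->
  (forall n, n%:R * q - C <= S n x) -> exists C' : R, forall n, n%:R * q' - C' <= S n y.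
Proof.
move=> ox oy qq h; have [C' hC'] := off_indep ox oy (e := q - q') ltac:(by rewrite subr_gt0).
exists (C + C') => n; have := h n; have := hC' n => /(le_trans (ler_norm _)); lra.
Qed.

Lemma off_rate' x y (q q' C : R) : off x -> off y -> q < q' ->
  (forall n, S n x <= n%:R * q + C) -> exists C' : R, forall n, S n y <= n%:R * q' + C'.
Proof.
move=> ox oy qq h; have [C' hC'] := off_indep oy ox (e := q' - q) ltac:(by rewrite subr_gt0).
exists (C + C') => n; have := h n; have := hC' n => /(le_trans (ler_norm _)); lra.
Qed.

(** Suppose the point [x] growing at nearly the rate [Lp] is off [theta]. Then all off points grow
    at rate at least [q], so growth near [Lm] can occur only at [theta]. If [Lm < 0], the
    contraction there spreads to an off point; if [Lm = 0], then [q > 0] and [x] violates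
    [off_nonexpanding]. *)
Lemma theta_lower (q : R) : Lm < Lp -> q < Lp -> exists C : R, forall n, n%:R * q - C <= S n theta.
Proof.
(* Replacing [q] by its maximum with the midpoint of [Lm] and [Lp] strengthens the claim and gives
   [Lm < q]. *)
move=> LL; wlog: q / Lm < q => [W|Lq qL].
  move=> qL; have [||C hC] := W (Num.max q ((Lm + Lp) / 2)).
  - by rewrite lt_max; apply/orP; right; lra.
  - by rewrite gt_max qL /=; lra.
  by exists C; apply: rate_weaken hC; rewrite le_max lexx.
pose q1 := (q + Lp) / 2.
have [|x [C hx]] := hxp (q := q1); first by rewrite /q1; lra.
have [ox|/notoff[z E]] := pselect (off x); last first.
  exists C => n; rewrite -(walk_logd_int n theta z) -E.
  by apply: (rate_weaken _ hx); rewrite /q1; lra.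
have allq y : off y -> exists C' : R, forall n, n%:R * q - C' <= S n y.
  by move=> oy; apply: off_rate ox oy _ hx; rewrite /q1; lra.
have thetaq r : Lm < r -> r < q -> exists C' : R, forall n, S n theta <= n%:R * r + C'.
  move=> Lr rq; have [y [C' hy]] := hxm Lr.
  have [oy|/notoff[z E]] := pselect (off y).
    by have [C2 hC2] := allq _ oy; case: (rate_conflict rq hC2 hy).
  by exists C' => n; rewrite -(walk_logd_int n theta z) -E.
exfalso; have [L0|L0] := ltP Lm 0.
  (* The rates used next lie a third and a half of the way from [Lm] to [p], hence are negative and
     below [q]. *)
  pose p := Num.min q 0; have Lp' : Lm < p by rewrite /p lt_min Lq.
  have pq : p <= q by rewrite /p ge_min lexx.
  have p0 : p <= 0 by rewrite /p ge_min lexx orbT.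
  have [||C' hC'] := thetaq (Lm + (p - Lm) / 3); [lra|lra|].
  have [||y [oy [C2 hC2]]] := contracting_theta_off (c' := Lm + (p - Lm) / 2) _ _ hC'; [lra|lra|].
  have [C3 hC3] := allq _ oy.
  by apply: (rate_conflict _ hC3 hC2); lra.
have [C2 hC2] := off_nonexpanding ox (e := q / 2) ltac:(lra).
by apply: (rate_conflict _ hx hC2); rewrite /q1; lra.
Qed.

(** A point of growth near [Lm] cannot be a translate of [theta], by [theta_lower]; being off
    [theta], it shares its rate with every off point. *)
Lemma off_upper x (q : R) : Lm < Lp -> off x -> Lm < q -> exists C : R, forall n, S n x <= n%:R * q + C.
Proof.
move=> LL ox Lq; pose r := Num.min q Lp.
have Lr : Lm < r by rewrite /r lt_min Lq.
have rq : r <= q by rewrite /r ge_min lexx.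
have rp : r <= Lp by rewrite /r ge_min lexx orbT.
have [|y [C hy]] := hxm (q := Lm + (r - Lm) / 3); first lra.
have [oy|/notoff[z E]] := pselect (off y).
  by apply: off_rate' oy ox _ hy; lra.
exfalso; have [|C' hC'] := theta_lower (q := Lm + (r - Lm) / 2) LL; first lra.
apply: (rate_conflict (u := S ^~ theta) _ hC' (C' := C)) => [|n]; last first.
  rewrite -(walk_logd_int n theta z) -E; exact: hy.
lra.
Qed.

(** [hup] and [hlo] give one half of each limit, [theta_lower] and [off_upper] the other; when
    [Lm = Lp] the first two are enough at every point. *)
Theorem exponent_dichotomy x :
  (fun n => n%:R^-1 * S n x) @ \oo --> (if `[< off x >] then Lm else Lp).
Proof.
have up y (e : R) : 0 < e -> exists C : R, forall n, S n y <= n%:R * (Lp + e) + C.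
  by move=> /hup[C hC]; exists C => n; exact: hC.
have lo y (e : R) : 0 < e -> exists C : R, forall n, n%:R * (Lm - e) - C <= S n y.
  by move=> /hlo[C hC]; exists C => n; exact: hC.
have LmLp : Lm <= Lp by exact: le_trans Lm0 Lp0.
have [LL|LL] := ltP Lm Lp; last first.
  have E : Lm = Lp by apply: le_anti; rewrite LmLp.
  rewrite E if_same; apply: rate_cvg => e e0; last exact: up.
  rewrite -E; exact: lo.
case: asboolP => [ox|/notoff[z ->]].
  by apply: rate_cvg => e e0; [exact: lo|apply: off_upper => //; lra].
apply: rate_cvg => e e0; last exact: up.
have [|C hC] := theta_lower (q := Lp - e) LL; first lra.
by exists C => n; rewrite walk_logd_int.
Qed.

End dichotomy.

(** * Covering argument and ergodic sums *)

Lemma sum_nat_split {R : realType} (F : nat -> R) j n : (j <= n)%N ->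
  \sum_(0 <= i < n) F i = \sum_(0 <= i < j) F i + \sum_(0 <= i < n - j) F (j + i)%N.
Proof.
move=> jn; rewrite (big_cat_nat (n:=j))//=; congr (_ + _).
rewrite -{1}(add0n j) big_addn; apply: eq_bigr => i _; by rewrite addnC.
Qed.

(* Katznelson-Weiss covering: the time interval [0, n) is covered by blocks on which
   the cocycle is nonpositive, by single bad times, and by a last block of length
   at most [N]. *)
Lemma cocycle_covering {R : realType} (b : nat -> nat -> R) (y : nat -> R)
    (bad : pred nat) (N : nat) :
  (forall k, 0 <= y k) ->
  (forall k i j, b k (i + j)%N = b k i + b (k + i)%N j) ->
  (forall k, b k 1%N <= y k) ->
  (forall k, ~~ bad k -> exists j, (0 < j <= N)%N /\ b k j <= 0) ->
  forall n k, b k n <= \sum_(0 <= i < n) (if bad (k + i)%N then y (k + i)%N else 0) +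
                       \sum_(0 <= i < n) (if (n <= i + N)%N then y (k + i)%N else 0).
Proof.
move=> y0 bD b1 hbad.
have bz k : b k 0%N = 0.
  have := bD k 0%N 0%N; rewrite !addn0 => h; lra.
have bsum n k : b k n <= \sum_(0 <= i < n) y (k + i)%N.
  elim: n => [|n IH]; first by rewrite bz big_geq.
  by rewrite big_nat_recr//= -[in leLHS]addn1 bD lerD.
have bad0 k : 0 <= (if bad k then y k else 0) by case: ifP.
elim/ltn_ind => n IH k; have [nN|Nn] := leqP n N.
  apply: (le_trans (bsum n k)); rewrite -[leLHS]add0r lerD ?sumr_ge0//.
  by apply: ler_sum_nat => i _; rewrite ifT// (leq_trans nN)// leq_addl.
(* The first block: a single step if [k] is bad, otherwise the nonpositive block supplied by
   [hbad]. *)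
have [j [j0 jn hj]] : exists j, [/\ (0 < j)%N, (j <= n)%N &
    b k j <= \sum_(0 <= i < j) (if bad (k + i)%N then y (k + i)%N else 0)].
  have [bk|/hbad[j [/andP[j0 jN] hj]]] := boolP (bad k).
    exists 1%N; split=> //; first exact: leq_trans Nn.
    by rewrite big_nat1 addn0 bk.
  exists j; split=> //; first exact/ltnW/(leq_ltn_trans jN).
  by apply: (le_trans hj); rewrite sumr_ge0.
rewrite -{1}(subnKC jn) bD !(sum_nat_split _ jn).
have := IH (n - j)%N _ (k + j)%N; rewrite ltn_subrL j0 (leq_trans j0 jn) => /(_ isT).
have -> : \sum_(0 <= i < n - j) (if bad (k + (j + i))%N then y (k + (j + i))%N else 0) =
    \sum_(0 <= i < n - j) (if bad (k + j + i)%N then y (k + j + i)%N else 0).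
  by apply: eq_bigr => i _; rewrite addnA.
have -> : \sum_(0 <= i < n - j) (if (n <= j + i + N)%N then y (k + (j + i))%N else 0) =
    \sum_(0 <= i < n - j) (if (n - j <= i + N)%N then y (k + j + i)%N else 0).
  by apply: eq_bigr => i _; rewrite addnA leq_subLR addnA.
have : 0 <= \sum_(0 <= i < j) (if (n <= i + N)%N then y (k + i)%N else 0).
  by apply: sumr_ge0 => i _; case: ifP.
lra.
Qed.

Lemma ge0_integral_preserving {R : realType} d1 d2 (X : measurableType d1) (Y : measurableType d2)
    (mu : {measure set X -> \bar R}) (nu : {measure set Y -> \bar R}) (phi : X -> Y)
    (f : Y -> \bar R) :
  measurable_fun setT phi -> (forall A, measurable A -> mu (phi @^-1` A) = nu A) ->
  measurable_fun setT f -> (forall y, 0 <= f y)%E ->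
  (\int[mu]_x f (phi x) = \int[nu]_y f y)%E.
Proof.
move=> mphi hphi mf f0.
transitivity (\int[pushforward mu phi]_y f y)%E.
  by rewrite ge0_integral_pushforward.
apply: (@eq_measure_integral _ _ _ setT nu
  (measure_function_pushforward__canonical__measure_function_Measure mu mphi)) => A mA _.
exact: hphi.
Qed.

Section ergodic.
Context {R : realType} {d : measure_display} {T : measurableType d}.
Variables (P : probability T R) (s : T -> T).
Hypothesis ms : measurable_fun setT s.
Hypothesis hs : forall A, measurable A -> P (s @^-1` A) = P A.
(** Ergodicity is phrased for forward invariant sets, such as the set of points whose whole orbit
    stays in a given set. *)
Hypothesis erg : forall B, measurable B -> B `<=` s @^-1` B -> P B = 0%E \/ P B = 1%E.

Lemma integral_const (c : R) : (\int[P]_x c%:E = c%:E)%E.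
Proof. by rewrite -[RHS]mule1 -(probability_setT P) -integral_cst. Qed.

Lemma measurable_iter i : measurable_fun setT (iter i s).
Proof. by elim: i => [|i IH]; [exact: measurable_id|exact: measurableT_comp]. Qed.

Lemma iter_preserving i A : measurable A -> P (iter i s @^-1` A) = P A.
Proof.
elim: i A => [//|i IH] A mA.
have -> : iter i.+1 s @^-1` A = iter i s @^-1` (s @^-1` A) by [].
rewrite IH ?hs//; by rewrite -[X in measurable X]setTI; exact: ms.
Qed.

Lemma integral_iter i (f : T -> \bar R) : measurable_fun setT f -> (forall x, 0 <= f x)%E ->
  (\int[P]_x f (iter i s x) = \int[P]_x f x)%E.
Proof.
move=> mf f0; apply: ge0_integral_preserving => //; first exact: measurable_iter.
by move=> A mA; exact: iter_preserving.
Qed.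

Lemma integral_sum_iter n (f : T -> R) : measurable_fun setT f -> (forall x, 0 <= f x) ->
  (\int[P]_x (\sum_(0 <= i < n) f (iter i s x))%:E = n%:R%:E * \int[P]_x (f x)%:E)%E.
Proof.
move=> mf f0.
under eq_integral do rewrite -sumEFin.
rewrite ge0_integral_sum//; last 2 first.
- move=> i; apply/measurable_EFinP; apply: measurableT_comp => //; exact: measurable_iter.
- by move=> i x _; rewrite lee_fin.
under eq_bigr => i _.
  rewrite (@integral_iter i (EFin \o f)); [|by apply/measurable_EFinP|by move=> x; rewrite lee_fin].
  over.
elim: n => [|n IH]; first by rewrite big_geq// mul0e.
by rewrite big_nat_recr//= IH -natr1 EFinD ge0_muleDl ?lee_fin// mul1e.
Qed.

(** By monotone convergence the integrals of [y] over [A N] increase to its integral over the union,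
    which is the full one since the complement is null. *)
Lemma integral_tail_small (y : T -> R) (A : nat -> set T) (e : R) :
  measurable_fun setT y -> (forall x, 0 <= y x) -> (\int[P]_x (y x)%:E < +oo)%E ->
  (forall N, measurable (A N)) -> nondecreasing_seq A -> P (\bigcup_N A N) = 1%E ->
  0 < e -> exists N, (\int[P]_x (y x * \1_(~` A N) x)%:E <= e%:E)%E.
Proof.
move=> my y0 yoo mA ndA PA e0.
have mE : measurable_fun setT (EFin \o y) by apply/measurable_EFinP.
have E0 x : (0 <= (EFin \o y) x)%E by rewrite lee_fin.
have mB : measurable (\bigcup_N A N) by exact: bigcup_measurable.
have IE (B : set T) : measurable B ->
    (\int[P]_x (y x)%:E = \int[P]_(x in B) (y x)%:E + \int[P]_(x in ~` B) (y x)%:E)%E.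
  move=> mB'; rewrite -(setUv B) ge0_integral_setU//.
  - exact: measurableC.
  - by rewrite setUv.
  - by move=> x _; rewrite lee_fin.
  - by apply/disj_setPS; rewrite setICr.
have cv : (\int[P]_(x in A N) (y x)%:E @[N --> \oo] --> \int[P]_x (y x)%:E)%E.
  rewrite (IE _ mB) [X in (_ + X)%E]null_set_integral ?adde0; last 3 first.
  - exact: measurableC.
  - exact: measurable_funTS.
  - by have := probability_setC P mB; rewrite PA subee// => h; exact: h.
  apply: ge0_nondecreasing_set_cvg_integral => //.
  - by move=> i; exact: measurable_funTS.
  - by move=> i x _; exact: E0.
have fin : (\int[P]_x (y x)%:E)%E \is a fin_num.
  by rewrite ge0_fin_numE// integral_ge0// => x _; exact: E0.
have [N _ hN] : \forall N \near \oo, (\int[P]_x (y x)%:E - e%:E < \int[P]_(x in A N) (y x)%:E)%E.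
  apply: (cv [set x | (_ < x)%E]); apply: open_nbhs_nbhs; split.
    exact: open_ereal_gt_ereal.
  suff : (\int[P]_x (y x)%:E - e%:E < \int[P]_x (y x)%:E)%E by [].
  by rewrite lteBlDr// lteDl// lte_fin.
exists N; have {}hN := hN N (leqnn N).
rewrite (_ : (\int[P]_x _ = \int[P]_(x in ~` A N) (y x)%:E)%E); last first.
  rewrite [RHS]integral_mkcond; apply: eq_integral => x _.
  by rewrite patchE indicE; case: (x \in ~` A N); rewrite ?mulr1 ?mulr0.
have finA : (\int[P]_(x in A N) (y x)%:E)%E \is a fin_num.
  rewrite ge0_fin_numE; last by apply: integral_ge0 => x _; exact: E0.
  apply: le_lt_trans yoo; apply: ge0_subset_integral => // x _; exact: E0.
move: hN; rewrite (IE _ (mA N)) lteBlDr// lteD2lE//.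
exact: ltW.
Qed.


Lemma measurable_le (f : T -> R) (c : R) : measurable_fun setT f ->
  measurable [set w | f w <= c].
Proof.
move=> mf; rewrite (_ : [set w | _] = setT `&` f @^-1` `]-oo, c]); first exact: mf.
by rewrite setTI; apply/seteqP; split => w /=; rewrite in_itv.
Qed.

(** * Covering over a fibred system *)

Section covering.
(** Only the base [T] carries a measure; [E] lies over it through [pr], and [a] is a cocycle over
    [sk]. [U] and [V] turn a bound on [a] over a whole fibre into a comparison of nonnegative
    functions on [T], whose integrals always make sense. *)
Variables (E : Type) (sk : E -> E) (pr : E -> T) (a : E -> nat -> R) (y : T -> R).
Variables (U V : nat -> T -> R).
Hypothesis hpr : forall p, pr (sk p) = s (pr p).
Hypothesis aD : forall p i j, a p (i + j)%N = a p i + a (iter i sk p) j.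
Hypothesis my : measurable_fun setT y.
Hypothesis y0 : forall w, 0 <= y w.
Hypothesis yoo : (\int[P]_x (y x)%:E < +oo)%E.
Hypothesis ay : forall p, a p 1%N <= y (pr p).
Hypothesis mU : forall n, measurable_fun setT (U n).
Hypothesis mV : forall n, measurable_fun setT (V n).
Hypothesis U0 : forall n w, 0 <= U n w.
Hypothesis V0 : forall n w, 0 <= V n w.
Hypothesis UV : forall n w B, (forall p, pr p = w -> a p n <= B) -> U n w <= V n w + B.

(** The covering inequality is integrated: by invariance each time costs the integral of [y] off
    [A], and the last block at most [N] integrals of [y]. *)
Lemma covering_integral (A : set T) (N : nat) : measurable A ->
  (forall p, A (pr p) -> exists j, (0 < j <= N)%N /\ a p j <= 0) ->
  forall n, (\int[P]_x (U n x)%:E <= \int[P]_x (V n x)%:E +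
    (n%:R%:E * \int[P]_x (y x * \1_(~` A) x)%:E + N%:R%:E * \int[P]_x (y x)%:E))%E.
Proof.
move=> mA hA n.
pose f w := y w * \1_(~` A) w.
have mf : measurable_fun setT f by apply: measurable_funM => //; exact/measurable_indic/measurableC.
have f0 w : 0 <= f w by rewrite mulr_ge0.
pose F w := \sum_(0 <= i < n) f (iter i s w).
(* With truncated subtraction [n - (n - N)] is the minimum of [n] and [N], the number of times
   charged to the last block. *)
pose g w := \sum_(0 <= i < n - (n - N)) y (iter i s w).
pose G w := g (iter (n - N) s w).
have mg : measurable_fun setT g.
  by apply: measurable_sum => i; apply: measurableT_comp => //; exact: measurable_iter.
have mF : measurable_fun setT F.
  by apply: measurable_sum => i; apply: measurableT_comp => //; exact: measurable_iter.
have mG : measurable_fun setT G by apply: measurableT_comp => //; exact: measurable_iter.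
have g0 w : 0 <= g w by exact: sumr_ge0.
have F0 w : 0 <= F w by exact: sumr_ge0.
have G0 w : 0 <= G w by exact: g0.
have iterpr i p : pr (iter i sk p) = iter i s (pr p).
  by elim: i => //= i IH; rewrite hpr IH.
have pt w : U n w <= V n w + (F w + G w).
  apply: UV => p pw.
  pose bad k := iter k s w \in ~` A.
  have H1 k i j : a (iter k sk p) (i + j)%N = a (iter k sk p) i + a (iter (k + i) sk p) j.
    by rewrite aD -iterD addnC.
  have H2 k : a (iter k sk p) 1%N <= y (iter k s w).
    by apply: (le_trans (ay _)); rewrite iterpr pw.
  have H3 k : ~~ bad k -> exists j, (0 < j <= N)%N /\ a (iter k sk p) j <= 0.
    rewrite /bad notin_setE => /contrapT hk; apply: hA.
    by rewrite iterpr pw.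
  have := @cocycle_covering R (fun k => a (iter k sk p)) (fun k => y (iter k s w)) bad N
    (fun k => y0 _) H1 H2 H3 n 0%N => /=.
  have -> : \sum_(0 <= i < n) (if bad (0 + i)%N then y (iter (0 + i) s w) else 0) = F w.
    apply: eq_bigr => i _; rewrite add0n /f indicE /bad.
    by case: (_ \in _); rewrite ?mulr1 ?mulr0.
  have -> : \sum_(0 <= i < n) (if (n <= i + N)%N then y (iter (0 + i) s w) else 0) = G w.
    rewrite (sum_nat_split _ (leq_subr N n)) big1_seq ?add0r; last first.
      move=> i; rewrite mem_index_iota andTb => /andP[_ h].
      by rewrite ltn_subRL addnC in h; rewrite leqNgt h.
    apply: eq_bigr => i _; rewrite add0n -iterD (addnC i) ifT// addnAC.
    by apply: leq_trans (leq_addr i _); rewrite addnC -leq_subLR.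
  by [].
apply: (@le_trans _ _ (\int[P]_x ((V n x)%:E + ((F x)%:E + (G x)%:E)))%E).
  apply: ge0_le_integral => //.
  - by move=> x _; rewrite lee_fin.
  - exact/measurable_EFinP.
  - by apply: emeasurable_funD; [|apply: emeasurable_funD]; exact/measurable_EFinP.
  - by move=> x _; rewrite -!EFinD lee_fin.
rewrite ge0_integralD//=; last 4 first.
- by move=> x _; rewrite lee_fin.
- exact/measurable_EFinP.
- by move=> x _; rewrite -EFinD lee_fin addr_ge0.
- by apply: emeasurable_funD; exact/measurable_EFinP.
rewrite leeD2l// ge0_integralD//=; last 4 first.
- by move=> x _; rewrite lee_fin F0.
- exact/measurable_EFinP.
- by move=> x _; rewrite lee_fin G0.
- exact/measurable_EFinP.
rewrite leeD//; first by rewrite integral_sum_iter.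
rewrite (@integral_iter (n - N) (EFin \o g)); [|by apply/measurable_EFinP|by move=> x; rewrite lee_fin].
rewrite integral_sum_iter// lee_pmul//.
- by apply: integral_ge0 => x _; rewrite lee_fin.
- by rewrite lee_fin ler_nat leq_subCl leqnn.
Qed.

(** The set of points whose orbit never leaves the union of the [A N] is forward invariant, so it
    has probability 0 or 1. Probability 0 is the first alternative; if it is 1, the covering is
    integrated with [N] so large that bad times cost at most [e] on average. *)
Lemma ergodic_alternative (A : nat -> set T) :
  (forall N, measurable (A N)) -> nondecreasing_seq A ->
  (forall N p, A N (pr p) -> exists j, (0 < j <= N)%N /\ a p j <= 0) ->
  (\forall w \ae P, exists k, ~ (\bigcup_N A N) (iter k s w)) \/
  (forall e : R, 0 < e -> exists C : R, forall n,
    (\int[P]_x (U n x)%:E <= \int[P]_x (V n x)%:E + (n%:R * e + C)%:E)%E).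
Proof.
move=> mA ndA hA.
have mUA : measurable (\bigcup_N A N) by exact: bigcup_measurable.
pose B := \bigcap_k (iter k s @^-1` (\bigcup_N A N)).
have mB : measurable B.
  apply: bigcap_measurable => // k _; rewrite -[X in measurable X]setTI.
  exact: measurable_iter.
have [||PB|PB] := @erg B.
- by [].
- by move=> w Bw k _ /=; rewrite -iterSr; exact: Bw.
- left; exists B; split => // w /= h k _ /=; apply: contrapT => h'.
  by apply: h; exists k.
right => e e0.
have PA : P (\bigcup_N A N) = 1%E.
  apply/eqP; rewrite eq_le probability_le1//= -PB le_measure ?inE//.
  by move=> w /(_ 0%N I).
have [N hN] := integral_tail_small my y0 yoo mA ndA PA e0.
exists (N%:R * fine (\int[P]_x (y x)%:E)) => n.
apply: (le_trans (covering_integral (mA N) (hA N) n)).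
have yfin : (\int[P]_x (y x)%:E)%E \is a fin_num.
  by rewrite ge0_fin_numE// integral_ge0// => x _; rewrite lee_fin.
by rewrite leeD2l// EFinD !EFinM fineK// leeD2r// lee_wpmul2l// lee_fin.
Qed.

End covering.

(** If blocks on which [X] averages at least [q] covered almost every orbit, integration would give
    [q <= \int X]. So almost every orbit reaches a point from which all sums stay below [n q]; the
    terms before it enter [C]. *)
Lemma birkhoff_upper (X : T -> R) (q : R) : measurable_fun setT X -> (forall w, 0 <= X w) ->
  (\int[P]_x (X x)%:E < q%:E)%E ->
  \forall w \ae P, exists C : R, forall n, \sum_(0 <= i < n) X (iter i s w) <= n%:R * q + C.
Proof.
move=> mX X0 Xq.
have I0 : (0 <= \int[P]_x (X x)%:E)%E by apply: integral_ge0 => x _; rewrite lee_fin.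
have q0 : 0 <= q by rewrite -lee_fin; exact/ltW/(le_lt_trans I0).
have Xfin : (\int[P]_x (X x)%:E)%E \is a fin_num.
  by rewrite ge0_fin_numE// (lt_trans Xq)// ltry.
pose a w n := \sum_(0 <= i < n) (q - X (iter i s w)).
have aE w n : a w n = n%:R * q - \sum_(0 <= i < n) X (iter i s w).
  by rewrite /a sumrB sumr_const_nat subn0 mulr_natl.
pose A N := \bigcup_(j in [set j | (0 < j <= N)%N]) [set w | a w j <= 0].
have mS n : measurable_fun setT (fun w => \sum_(0 <= i < n) X (iter i s w)).
  by apply: measurable_sum => i; apply: measurableT_comp => //; exact: measurable_iter.
have h2 w i j : a w (i + j)%N = a w i + a (iter i s w) j.
  rewrite /a (sum_nat_split _ (leq_addr j i)) addKn; congr (_ + _).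
  by apply: eq_bigr => k _; rewrite addnC iterD.
have h3 : (\int[P]_x (cst q x)%:E < +oo)%E.
  by rewrite /= integral_const ltry.
have h4 w : a w 1%N <= cst q w by rewrite /a big_nat1 /= gerBl.
have h5 n w B : (forall p, id p = w -> a p n <= B) ->
    cst (n%:R * q) w <= \sum_(0 <= i < n) X (iter i s w) + B.
  by move=> /(_ w erefl); rewrite aE lerBlDl.
have mA N : measurable (A N).
  apply: bigcup_measurable => j _; apply: measurable_le.
  under eq_fun do rewrite aE; exact: measurable_funB.
have ndA : nondecreasing_seq A.
  apply/nondecreasing_seqP => N; rewrite subsetEset => w [j /andP[j0 jN] hj].
  by exists j => //=; rewrite j0 ltnW.
have hA N w : A N (id w) -> exists j, (0 < j <= N)%N /\ a w j <= 0.
  by move=> [j jN hj]; exists j.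
have [h|h] := @ergodic_alternative T s id a (cst q)
    (fun n => cst (n%:R * q)) (fun n w => \sum_(0 <= i < n) X (iter i s w))
    (fun=> erefl) h2 (measurable_cst _) (fun=> q0) h3 h4 (fun=> measurable_cst _) mS
    (fun n w => mulr_ge0 (ler0n _ _) q0) (fun n w => sumr_ge0 _ (fun i _ => X0 _)) h5 A mA ndA hA.
  apply: filterS h => w [k hk].
  exists (\sum_(0 <= i < k) X (iter i s w)) => n.
  have [nk|kn] := leqP n k.
    rewrite (sum_nat_split _ nk) addrCA lerDl; apply: addr_ge0; last exact: sumr_ge0.
    by rewrite mulr_ge0.
  rewrite (sum_nat_split _ (ltnW kn)) addrC lerD2r.
  under eq_bigr do rewrite addnC iterD.
  have : 0 < a (iter k s w) (n - k)%N.
    rewrite ltNge; apply/negP => h; apply: hk; exists (n - k)%N => //.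
    by exists (n - k)%N => //=; rewrite subn_gt0 kn leqnn.
  rewrite aE subr_gt0 => /ltW /le_trans; apply; apply: ler_wpM2r => //.
  by rewrite ler_nat leq_subr.
pose I := fine (\int[P]_x (X x)%:E).
have Iq : I < q by rewrite -lte_fin fineK.
have [|C hC] := h ((q - I) / 2); first by rewrite divr_gt0// subr_gt0.
exfalso; apply: (@rate_conflict R (fun n => n%:R * q) q (I + (q - I) / 2) 0 C).
- lra.
- by move=> n; rewrite subr0.
move=> n; have := hC n; rewrite /= integral_const integral_sum_iter//.
by rewrite -(fineK Xfin) -EFinM -EFinD lee_fin -/I mulrDr addrA.
Qed.

End ergodic.

(** Upper half of the subadditive ergodic theorem. Time is cut into blocks of length [m], and the
    additive bound is applied to [M m] along the [m]-th iterate of [s]; hence ergodicity is required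
    of that iterate. *)
Lemma kingman_upper {R : realType} {d : measure_display} {T : measurableType d}
    (P : probability T R) (s : T -> T) (M : nat -> T -> R) (m : nat) (q : R) :
  measurable_fun setT s -> (forall A, measurable A -> P (s @^-1` A) = P A) ->
  (forall B, measurable B -> B `<=` iter m s @^-1` B -> P B = 0%E \/ P B = 1%E) ->
  (0 < m)%N -> (forall n, measurable_fun setT (M n)) -> (forall n w, 0 <= M n w) ->
  (forall w, M 0%N w = 0) ->
  (forall i j w, M (i + j)%N w <= M i w + M j (iter i s w)) ->
  (\int[P]_x (M 1%N x)%:E < +oo)%E ->
  (\int[P]_x (M m x)%:E < (m%:R * q)%:E)%E ->
  \forall w \ae P, exists C : R, forall n, M n w <= n%:R * q + C.
Proof.
move=> ms hs erg m0 mM M0 Mz Msub M1 Mm.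
have mi := measurable_iter ms.
(* By subadditivity [Y] dominates [M r] for every [r <= m], hence the incomplete block. *)
pose Y w := \sum_(0 <= i < m) M 1%N (iter i s w).
have mY : measurable_fun setT Y by apply: measurable_sum => i; exact: measurableT_comp.
have Y0 w : 0 <= Y w by exact: sumr_ge0.
have Mle r w : (r <= m)%N -> M r w <= Y w.
  move=> rm; apply: (@le_trans _ _ (\sum_(0 <= i < r) M 1%N (iter i s w))).
    elim: r {rm} => [|r IH]; first by rewrite Mz big_geq.
    by rewrite big_nat_recr//= -[in leLHS]addn1 (le_trans (Msub _ _ _))// lerD2r.
  by rewrite /Y (sum_nat_split _ rm) lerDl; exact: sumr_ge0.
have I0 : (0 <= \int[P]_x (M m x)%:E)%E by apply: integral_ge0 => x _; rewrite lee_fin.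
have q0 : 0 <= q.
  have := le_lt_trans I0 Mm; rewrite lte_fin pmulr_rgt0 ?ltr0n//; exact: ltW.
have Ifin : (\int[P]_x (M m x)%:E)%E \is a fin_num.
  by rewrite ge0_fin_numE// (lt_trans Mm)// ltry.
have Yoo : (\int[P]_x (Y x)%:E < +oo)%E.
  rewrite integral_sum_iter//.
  have : (\int[P]_x (M 1%N x)%:E)%E \is a fin_num.
    by rewrite ge0_fin_numE// integral_ge0// => x _; rewrite lee_fin.
  by move=> h; rewrite -(fineK h) -EFinM ltry.
pose I := fine (\int[P]_x (M m x)%:E).
have Iq : I < m%:R * q by rewrite -lte_fin fineK.
pose A N := [set w | Y w <= N%:R].
have [||||N hN] := @integral_tail_small _ _ _ P Y A ((m%:R * q - I) / 2) mY Y0 Yoo.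
- by move=> N; exact: measurable_le.
- apply/nondecreasing_seqP => N; rewrite subsetEset => w /= /le_trans; apply.
  by rewrite ler_nat.
- rewrite (_ : \bigcup_N A N = setT) ?probability_setT//.
  apply/seteqP; split=> // w _; exists (Num.truncn (Y w)).+1 => //=.
  exact/ltW/truncnS_gt.
- by rewrite divr_gt0// subr_gt0.
(* The last incomplete block is bounded by [N] except when [Y] exceeds [N]; adding this
   small excess to [M m] lets a single Birkhoff bound control all the terms. *)
pose X w := M m w + Y w * \1_(~` A N) w.
have mYI : measurable_fun setT (fun w => Y w * \1_(~` A N) w).
  by apply: measurable_funM => //; apply/measurable_indic/measurableC/measurable_le.
have mX : measurable_fun setT X by exact: measurable_funD.
have X0 w : 0 <= X w by rewrite addr_ge0// mulr_ge0.
have Xq : (\int[P]_x (X x)%:E < (m%:R * q)%:E)%E.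
  under eq_integral do rewrite EFinD.
  rewrite ge0_integralD//; last 4 first.
  - by move=> x _; rewrite lee_fin.
  - exact/measurable_EFinP.
  - by move=> x _; rewrite lee_fin mulr_ge0.
  - exact/measurable_EFinP.
  rewrite -(fineK Ifin) -/I; apply: (@le_lt_trans _ _ (I%:E + ((m%:R * q - I) / 2)%:E)%E).
    by rewrite leeD2l.
  rewrite -EFinD lte_fin; lra.
have := @birkhoff_upper _ _ _ P (iter m s) (mi m) (iter_preserving ms hs m) erg X _ mX X0 Xq.
apply: filterS => w [C hC].
(* The incomplete block contributes [N] and one more term of [X]; summing [j + 1] terms instead of
   [j] costs the extra [m q]. *)
exists (N%:R + m%:R * q + C) => n.
pose j := (n %/ m)%N.
have Mj : M (j * m)%N w <= \sum_(0 <= i < j) M m (iter i (iter m s) w).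
  elim: j => [|j IH]; first by rewrite mul0n Mz big_geq.
  rewrite big_nat_recr//= mulSnr (le_trans (Msub _ _ _))// lerD//.
  by rewrite iterM.
have Mr : M (n %% m)%N (iter (j * m) s w) <= N%:R + X (iter j (iter m s) w).
  rewrite iterM; set w' := iter j _ w; apply: (le_trans (Mle _ _ _)).
    exact/ltnW/ltn_pmod.
  rewrite /X indicE; have [/set_mem|/negP] := boolP (w' \in ~` A N).
    by move=> _; rewrite mulr1 addrA lerDr addr_ge0.
  rewrite inE => /contrapT /= h; rewrite mulr0 addr0 (le_trans h)// lerDl; exact: M0.
have := hC j.+1; rewrite big_nat_recr//=.
have : \sum_(0 <= i < j) M m (iter i (iter m s) w) <= \sum_(0 <= i < j) X (iter i (iter m s) w).
  by apply: ler_sum => i _; rewrite /X lerDl mulr_ge0.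
have := Msub (j * m)%N (n %% m)%N w; rewrite -divn_eq.
have : j%:R * (m%:R * q) <= n%:R * q.
  by rewrite mulrA -natrM ler_wpM2r// ler_nat leq_trunc_div.
rewrite -natr1 mulrDl mul1r; lra.
Qed.

(** * Measurability and the product space *)

Section measurability.
Context {R : realType} {d : measure_display} {T : measurableType d}.
Implicit Types f : T -> R.

Lemma measurable_of_gt f : (forall a, measurable [set w | a < f w]) -> measurable_fun setT f.
Proof.
move=> h; apply: (measurability _ (RGenOInfty.measurableE R)).
move=> _ [_ [a ->] <-]; rewrite setTI.
rewrite [X in measurable X](_ : _ = [set w | a < f w])//.
by apply/seteqP; split => w /=; rewrite in_itv /= andbT.
Qed.

Lemma measurable_gt f a : measurable_fun setT f -> measurable [set w | a < f w].
Proof.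
move=> mf; rewrite (_ : [set w | _] = ~` [set w | f w <= a]).
  exact/measurableC/measurable_le.
by apply/seteqP; split => w /=; rewrite ltNge => /negP.
Qed.

Lemma measurable_of_le f : (forall a, measurable [set w | f w <= a]) -> measurable_fun setT f.
Proof.
move=> h; apply: measurable_of_gt => a.
rewrite (_ : [set w | _] = ~` [set w | f w <= a]); first exact/measurableC.
by apply/seteqP; split => w /=; rewrite ltNge => /negP.
Qed.

Lemma measurable_bigcap_rat (F : rat -> set T) : (forall q, measurable (F q)) ->
  measurable (\bigcap_q F q).
Proof.
move=> mF; rewrite -[X in measurable X]setCK setC_bigcap; apply: measurableC.
by apply: bigcupT_measurable_rat => q; exact: measurableC.
Qed.

(** [X] is rounded down to the grid of mesh [1/(k+1)]; on each of the countably many level sets [h]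
    is evaluated at a fixed point, and continuity gives the limit. This allows random maps to be
    evaluated at random points. *)
Lemma caratheodory_measurable (h : T -> R -> R) (X : T -> R) :
  (forall x, measurable_fun setT (h ^~ x)) -> (forall w, continuous (h w)) ->
  measurable_fun setT X -> measurable_fun setT (fun w => h w (X w)).
Proof.
move=> mh ch mX.
pose Xk (k : nat) w : R := (Num.floor (X w * k.+1%:R))%:~R / k.+1%:R.
have k0 k : (0 : R) < k.+1%:R by rewrite ltr0n.
have XkP k w : Xk k w <= X w < Xk k w + k.+1%:R^-1.
  have /andP[h1 h2] := floor_itv (X w * k.+1%:R).
  have -> : Xk k w + k.+1%:R^-1 = (Num.floor (X w * k.+1%:R) + 1)%:~R / k.+1%:R.
    by rewrite intrD mulrDl mul1r.
  by rewrite /Xk ler_pdivrMr// h1 ltr_pdivlMr.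
apply: (@measurable_fun_cvg _ _ _ _ (fun k w => h w (Xk k w))) => [k|w _].
  apply: measurable_of_gt => a.
  rewrite (_ : [set w | _] = \bigcup_(i in [set: int])
    ([set w | Num.floor (X w * k.+1%:R) = i] `&` [set w | a < h w (i%:~R / k.+1%:R)])).
    apply: countable_bigcupT_measurable => [|i]; first exact: countableP.
    apply: measurableI; last exact: measurable_gt.
    rewrite (_ : [set w | _] = ~` [set w | X w * k.+1%:R < i%:~R] `&` [set w | X w * k.+1%:R < (i + 1)%:~R]).
      have mXk : measurable_fun setT (fun w => X w * k.+1%:R) by apply: measurable_funM.
      have mlt c : measurable [set w | X w * k.+1%:R < c].
        rewrite (_ : [set w | _] = ~` [set w | c <= X w * k.+1%:R]); last first.
          by apply/seteqP; split => w /=; rewrite ltNge => /negP.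
        apply: measurableC.
        rewrite (_ : [set w | _] = [set w | - (X w * k.+1%:R) <= - c]); last first.
          by apply/seteqP; split => w /=; rewrite lerN2.
        by apply: measurable_le; exact: measurable_funN.
      by apply: measurableI => //; exact: measurableC.
    apply/seteqP; split => w /=.
      by move=> <-; have /andP[h1 h2] := floor_itv (X w * k.+1%:R); split=> //; rewrite ltNge h1.
    by move=> [/negP h1 h2]; apply/floor_def; rewrite leNgt h1.
  apply/seteqP; split => w /=; first by move=> h1; exists (Num.floor (X w * k.+1%:R)).
  by move=> [i _ /= [<-]].
suff hX : (fun k => Xk k w) @ \oo --> X w by exact: (cvg_comp _ _ hX (ch w (X w))).
apply/cvgrPdist_lt => e e0; exists (Num.truncn e^-1).+1 => // n /= hn.
have /andP[h1 h2] := XkP n w; rewrite ger0_norm ?subr_ge0//.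
have : n.+1%:R^-1 < e.
  rewrite -[ltRHS]invrK ltf_pV2 ?posrE ?invr_gt0//.
  by apply: (lt_le_trans (truncnS_gt _)); rewrite ler_nat leqW.
by move=> he; rewrite ltrBlDl; apply: (lt_trans h2); rewrite ltrD2l.
Qed.

End measurability.

(** * Measurability of lifts, their derivatives and their inverses *)

Section diffeos.
Context {R : realType} (tau : R).
Hypothesis tau0 : 0 < tau.
Implicit Types f g : Diff1t tau.

(** The Hoelder bound gives continuity of the derivative since [tau > 0]: the radius [r] solves
    [C1 r^tau = e], where [C1 > 0] whatever the sign of [C]. *)
Lemma c1_lift_dlift f : c1_lift (dlift f).
Proof.
have [dF nF [C hC] pF _] := liftP f; split; [exact: dF| |exact: nF|exact: pF].
move=> x; apply/cvgrPdist_le => e e0.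
pose C1 := `|C| + 1; have C10 : 0 < C1 by rewrite ltr_wpDl.
pose r := (e / C1) `^ tau^-1.
have r0 : 0 < r by rewrite powR_gt0// divr_gt0.
apply/nbhs_ballP; exists r => // t; rewrite /ball /= => ht.
apply: (le_trans (hC _ _)); apply: (@le_trans _ _ (C1 * (`|x - t| `^ tau))).
  by rewrite ler_wpM2r ?powR_ge0// /C1 (le_trans (ler_norm _))// lerDl.
have -> : e = C1 * r `^ tau.
  rewrite /r -powRrM mulVf ?gt_eqF// powRr1; last exact: divr_ge0 (ltW e0) (ltW C10).
  by rewrite mulrC divfK// gt_eqF.
apply: ler_wpM2l; first exact: ltW.
by apply: (ge0_ler_powR (ltW tau0)); rewrite ?nnegrE ?normr_ge0 ?(ltW r0) ?(ltW ht).
Qed.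

Lemma c1open_measurable (U : set (Diff1t tau)) : c1open U -> measurable U.
Proof. exact: sub_sigma_algebra. Qed.

Lemma cdist_ge0 (x y : R) : 0 <= cdist x y.
Proof.
have /andP[h1 h2] := frac_itv (x - y).
by rewrite /cdist le_min h1 subr_ge0 ltW.
Qed.

(** Both sets in [c1dist] are bounded, so each [sup] is a genuine supremum and not a default value;
    both are nonnegative, so each is at most their sum. *)
Lemma c1dist_ge f g x : cdist (dlift f x) (dlift g x) <= c1dist f g /\
  `|derive1 (dlift f) x - derive1 (dlift g) x| <= c1dist f g.
Proof.
have ub1 : has_ubound [set cdist (dlift f x) (dlift g x) | x in [set: R]].
  exists 1 => _ [z _ <-]; rewrite /cdist ge_min.
  by have /andP[_ /ltW ->] := frac_itv (dlift f z - dlift g z).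
have bd (h : Diff1t tau) : exists C : R, forall z, `|derive1 (dlift h) z| <= C.
  have [C hC] := logd_bounded (c1_lift_dlift h); exists (expR C) => z.
  rewrite -expR_logd ?ler_expR; last exact: c1_lift_dlift.
  exact: le_trans (ler_norm _) (hC z).
have ub2 : has_ubound [set `|derive1 (dlift f) x - derive1 (dlift g) x| | x in [set: R]].
  have [C1 h1] := bd f; have [C2 h2] := bd g; exists (C1 + C2) => _ [z _ <-].
  by apply: (le_trans (ler_normB _ _)); exact: lerD.
have i1 := ub_le_sup ub1 (ex_intro2 _ _ x I erefl).
have i2 := ub_le_sup ub2 (ex_intro2 _ _ x I erefl).
rewrite /c1dist; split.
  by apply: (le_trans i1); rewrite lerDl; apply: le_trans i2.
by apply: (le_trans i2); rewrite lerDr; apply: le_trans i1; exact: cdist_ge0.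
Qed.

Lemma measurable_derive1_dlift x :
  measurable_fun setT (fun f : Diff1t tau => derive1 (dlift f) x).
Proof.
apply: measurable_of_gt => a; apply: c1open_measurable => f /= hf.
exists (derive1 (dlift f) x - a); first by rewrite subr_gt0.
move=> g; rewrite /c1ball /= => fg.
have [_ h] := c1dist_ge f g x.
have := le_lt_trans (le_trans (ler_norm _) h) fg; lra.
Qed.

(** Increments do not see the jump of the normalisation: the mean value theorem for the difference
    of the two lifts makes them Lipschitz in [c1dist]. *)
Lemma dlift_increment f g x :
  `|(dlift f x - dlift f 0) - (dlift g x - dlift g 0)| <= `|x| * c1dist f g.
Proof.
pose H := fun y => dlift f y - dlift g y.
have df y : derivable (dlift f) y 1 by case: (c1_lift_dlift f).
have dg y : derivable (dlift g) y 1 by case: (c1_lift_dlift g).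
have dH (y : R) : is_derive (y : R) (1 : R) H (derive1 (dlift f) y - derive1 (dlift g) y).
  rewrite !derive1E; apply: is_deriveB; exact/derivableP.
have cH : continuous H.
  by move=> y; apply: differentiable_continuous; apply/derivable1_diffP; have /@ex_derive := dH y.
have key a b : a <= b -> `|H b - H a| <= `|b - a| * c1dist f g.
  move=> ab; have [|c _ ->] := MVT_segment ab (f := H)
      (df := fun y => derive1 (dlift f) y - derive1 (dlift g) y).
    exact: continuous_subspaceT.
  by rewrite normrM mulrC ler_wpM2l//; have [] := c1dist_ge f g c.
have -> : dlift f x - dlift f 0 - (dlift g x - dlift g 0) = H x - H 0 by rewrite /H; lra.
have [x0|/ltW x0] := leP 0 x; first by have := key _ _ x0; rewrite subr0.
by have := key _ _ x0; rewrite distrC sub0r normrN.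
Qed.

Lemma measurable_dlift_increment x :
  measurable_fun setT (fun f : Diff1t tau => dlift f x - dlift f 0).
Proof.
apply: measurable_of_gt => a; apply: c1open_measurable => f /= hf.
have x1 : 0 < `|x| + 1 by rewrite ltr_wpDl.
exists ((dlift f x - dlift f 0 - a) / (`|x| + 1)).
  by rewrite divr_gt0// subr_gt0.
move=> g; rewrite /c1ball /= ltr_pdivlMr// => fg.
have h := dlift_increment f g x.
have c0 : 0 <= c1dist f g by have [_] := c1dist_ge f g x; exact: le_trans.
have := le_trans (ler_norm _) h; rewrite mulrC; lra.
Qed.

(* Lifts are normalised by [F 0] in [0, 1), so evaluation at [0] is not continuous for
   [c1dist]; it is nevertheless lower semicontinuous. *)
Lemma measurable_dlift0 : measurable_fun setT (fun f : Diff1t tau => dlift f 0).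
Proof.
have h01 (h : Diff1t tau) : 0 <= dlift h 0 < 1 by case: (liftP h).
apply: measurable_of_gt => a.
have [a0|a0] := ltP a 0.
  rewrite (_ : [set w | _] = setT)//; apply/seteqP; split => // f _ /=.
  by have /andP[h _] := h01 f; exact: lt_le_trans h.
apply: c1open_measurable => f /= hf.
have /andP[f0 f1] := h01 f.
(* If [dlift g 0 <= a], the two ways round the circle between the values at 0 have lengths at least
   [dlift f 0 - a] and [1 - dlift f 0]. *)
exists (Num.min (dlift f 0 - a) (1 - dlift f 0)).
  by rewrite lt_min !subr_gt0 hf.
move=> g; rewrite /c1ball /= => fg; have /andP[g0 g1] := h01 g.
have [h _] := c1dist_ge f g 0; have {fg}h := le_lt_trans h fg.
rewrite ltNge; apply/negP => ga; move: h; apply/negP; rewrite -leNgt.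
have E : Defs.frac (dlift f 0 - dlift g 0) = dlift f 0 - dlift g 0.
  rewrite /Defs.frac (_ : Num.floor _ = 0) ?subr0//.
  by apply/floor_def; rewrite /= add0r; apply/andP; split; lra.
by rewrite /cdist E le_min !ge_min; apply/andP; split; apply/orP; [left|right]; lra.
Qed.

Lemma measurable_dlift x : measurable_fun setT (fun f : Diff1t tau => dlift f x).
Proof.
have -> : (fun f : Diff1t tau => dlift f x) = (fun f => (dlift f x - dlift f 0) + dlift f 0).
  by apply/funext => f; rewrite subrK.
apply: measurable_funD; [exact: measurable_dlift_increment|exact: measurable_dlift0].
Qed.

Lemma measurable_logd_dlift x : measurable_fun setT (fun f : Diff1t tau => logd (dlift f) x).
Proof.
apply: measurableT_comp; first exact: measurable_ln.
apply: measurableT_comp; first exact: normr_measurable.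
exact: measurable_derive1_dlift.
Qed.

Lemma c1_lift_strict (F : R -> R) (a b : R) : c1_lift F -> a < b ->
  if 0 < derive1 F 0 then F a < F b else F b < F a.
Proof.
move=> hF ab; have [c _ E] := c1_lift_MVT hF (ltW ab).
have [s|s] := c1_lift_sign hF; rewrite ?s.
  by rewrite -subr_gt0 E mulr_gt0// subr_gt0.
by rewrite ltNge (ltW (s 0)) /= -subr_lt0 E nmulr_rlt0// subr_gt0.
Qed.

(** Monotonicity moves the inverse across the inequality, the orientation being read off the
    derivative at 0. Measurability of the inverse at [y] thus reduces to that of evaluation at
    [a]. *)
Lemma finv_gt (F : R -> R) (a y : R) : c1_lift F ->
  (a < Defs.finv F y) = if 0 < derive1 F 0 then F a < y else y < F a.
Proof.
move=> hF; have := finvK hF y; set x := Defs.finv F y => <-.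
have [ax|xa|->] := ltgtP a x.
- by have := c1_lift_strict hF ax; case: ifP.
- by have := c1_lift_strict hF xa; case: ifP => _ h; rewrite ltNge (ltW h).
- by rewrite !ltxx if_same.
Qed.

Lemma measurable_finv_dlift y : measurable_fun setT (fun f : Diff1t tau => Defs.finv (dlift f) y).
Proof.
apply: measurable_of_gt => a.
rewrite (_ : [set w | _] =
  ([set f : Diff1t tau | 0 < derive1 (dlift f) 0] `&` ~` [set f : Diff1t tau | y - dlift f a <= 0]) `|`
  (~` [set f : Diff1t tau | 0 < derive1 (dlift f) 0] `&` [set f : Diff1t tau | y < dlift f a])).
  have m1 : measurable [set f : Diff1t tau | 0 < derive1 (dlift f) 0].
    by apply: measurable_gt; exact: measurable_derive1_dlift.
  apply: measurableU; apply: measurableI => //.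
  - apply/measurableC/measurable_le/measurable_funB => //; exact: measurable_dlift.
  - exact: measurableC.
  - by apply: measurable_gt; exact: measurable_dlift.
apply/seteqP; split => f /=; rewrite finv_gt; try exact: c1_lift_dlift.
  case: ifP => [h h'|/negP h h']; [left|right] => //; split=> //.
  by apply/negP; rewrite -ltNge subr_gt0.
move=> [[-> /negP]|[/negP/negbTE-> //]].
by rewrite -ltNge subr_gt0.
Qed.

Lemma measurable_logd_finv_dlift y :
  measurable_fun setT (fun f : Diff1t tau => logd (Defs.finv (dlift f)) y).
Proof.
have -> : (fun f : Diff1t tau => logd (Defs.finv (dlift f)) y) =
    (fun f : Diff1t tau => - logd (dlift f) (Defs.finv (dlift f) y)).
  by apply/funext => f; rewrite logd_finv//; exact: c1_lift_dlift.
apply: measurable_funN.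
apply: (@caratheodory_measurable _ _ _ (fun f : Diff1t tau => logd (dlift f))
  (fun f : Diff1t tau => Defs.finv (dlift f) y)).
- exact: measurable_logd_dlift.
- by move=> f; apply: logd_continuous; exact: c1_lift_dlift.
- exact: measurable_finv_dlift.
Qed.

End diffeos.

(** * The product measure: shift, reversal of prefixes, zero-one law *)

Section product_space.
Context {R : realType} {tau : R}.
Variables (nu : probability (Diff1t tau) R) (P : probability (DiffN tau) R).
Hypothesis hP : is_product_measure nu P.
Implicit Types (A : nat -> set (Diff1t tau)) (B : set (DiffN tau)) (m n : nat).

Lemma measurable_coord n : measurable_fun setT (fun w : DiffN tau => (w n : Diff1t tau)).
Proof. by move=> _ A mA; apply: sub_sigma_algebra; exists n => //; exists A. Qed.

Lemma measurable_into d (T : measurableType d) (f : T -> DiffN tau) :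
  (forall n, measurable_fun setT (fun t => (f t n : Diff1t tau))) -> measurable_fun setT f.
Proof.
move=> mf; apply: (@measurability _ _ _ _ setT f (@seq_gens R tau) erefl).
move=> _ [_ [n _ [A mA <-]] <-]; rewrite setTI.
have := mf n measurableT A mA; rewrite setTI; congr measurable.
by apply/seteqP; split => t /=; [split|case].
Qed.

Definition rect n A : set (DiffN tau) := [set w | forall i, (i < n)%N -> A i (w i)].

Lemma measurable_rect n A : (forall i, measurable (A i)) -> measurable (rect n A).
Proof.
move=> mA; rewrite (_ : rect n A = \bigcap_(i in [set i | (i < n)%N])
  ((fun w : DiffN tau => (w i : Diff1t tau)) @^-1` A i)) //.
by apply: bigcap_measurableType => i _; rewrite -[X in measurable X]setTI; exact: measurable_coord.
Qed.

Lemma rect_pad n N A : (n <= N)%N ->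
  rect n A = rect N (fun i => if (i < n)%N then A i else setT).
Proof.
move=> nN; apply/seteqP; split => w h i iN; first by case: ifP => // /h.
by have := h i (leq_trans iN nN); rewrite iN.
Qed.

Lemma measurable_pad n A : (forall i, measurable (A i)) ->
  forall i, measurable (if (i < n)%N then A i else setT).
Proof. by move=> mA i; case: ifP. Qed.

(** Rectangles generate the sigma-algebra and are stable under intersection, once padded with [setT]
    to a common length. *)
Lemma rect_measure_unique (m1 m2 : {measure set (DiffN tau) -> \bar R}) :
  (forall n A, (forall i, measurable (A i)) -> m1 (rect n A) = m2 (rect n A)) ->
  (m1 setT < +oo)%E -> forall B, measurable B -> m1 B = m2 B.
Proof.
move=> h fin B mB.
pose G := [set B | exists n A, (forall i, measurable (A i)) /\ B = rect n A].
have Gm C : G C -> measurable C by move=> [n [A [mA ->]]]; exact: measurable_rect.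
have GT : G setT.
  by exists 0%N, (fun=> setT); split=> //; apply/seteqP; split.
apply: (measure_unique G (fun=> setT)) => //.
- apply/seteqP; split; last first.
    move=> C hC; apply: (hC measurable); split; last by move=> D /Gm.
    exact: sigma_algebra_measurable.
  apply: smallest_sub; first exact: smallest_sigma_algebra.
  move=> _ [n _ [A mA <-]]; apply: sub_sigma_algebra.
  exists n.+1, (fun i => if i == n then A else setT); split; first by move=> i; case: ifP.
  apply/seteqP; split => w /=.
    by move=> [_ hw] i _; case: eqP => // ->.
  by move=> /(_ n (ltnSn n)); rewrite eqxx.
- move=> _ _ [n [A [mA ->]]] [m [A' [mA' ->]]].
  exists (maxn n m), (fun i => (if (i < n)%N then A i else setT) `&` (if (i < m)%N then A' i else setT)); split.
    by move=> i; apply: measurableI; exact: measurable_pad.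
  rewrite (rect_pad A (leq_maxl n m)) (rect_pad A' (leq_maxr n m)).
  apply/seteqP; split => w /=; first by move=> [h1 h2] i hi; split; [exact: h1|exact: h2].
  by move=> hw; split=> i /hw[].
- by rewrite bigcup_const.
- by move=> C [n [A [mA ->]]]; exact: h.
Qed.

Definition shift (w : DiffN tau) : DiffN tau := fun n => w n.+1.
(** Exchanges the products [f_n ... f_1] and [f_1 ... f_n], which therefore have the same law. *)
Definition prefix_rev n (w : DiffN tau) : DiffN tau :=
  fun k => if (k < n)%N then w (n - k.+1)%N else w k.

Lemma measurable_shift : measurable_fun setT shift.
Proof. by apply: measurable_into => n; exact: measurable_coord. Qed.

Lemma measurable_prefix_rev n : measurable_fun setT (prefix_rev n).
Proof.
apply: measurable_into => k; case kn : (k < n)%N.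
  rewrite (_ : (fun w => _) = (fun w : DiffN tau => w (n - k.+1)%N)); first exact: measurable_coord.
  by apply/funext => w; rewrite /prefix_rev kn.
rewrite (_ : (fun w => _) = (fun w : DiffN tau => w k)); first exact: measurable_coord.
by apply/funext => w; rewrite /prefix_rev kn.
Qed.

Lemma preserving_of_rect (f : DiffN tau -> DiffN tau) : measurable_fun setT f ->
  (forall n A, (forall i, measurable (A i)) -> P (f @^-1` rect n A) = P (rect n A)) ->
  forall B, measurable B -> P (f @^-1` B) = P B.
Proof.
move=> mf h B mB.
apply: (@rect_measure_unique
  (measure_function_pushforward__canonical__measure_function_Measure P mf) P) => //.
by rewrite /= /pushforward preimage_setT probability_setT ltry.
Qed.

Lemma P_rect n A : (forall i, measurable (A i)) -> P (rect n A) = (\prod_(i < n) fine (nu (A i)))%:E.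
Proof. exact: hP. Qed.

Lemma nuT : fine (nu setT) = 1.
Proof. by rewrite probability_setT. Qed.

Lemma shift_preserving B : measurable B -> P (shift @^-1` B) = P B.
Proof.
apply: preserving_of_rect; first exact: measurable_shift.
move=> n A mA.
rewrite (_ : shift @^-1` _ = rect n.+1 (fun i => if i is j.+1 then A j else setT)).
  rewrite P_rect; last by case.
  by rewrite big_ord_recl nuT mul1r P_rect.
apply/seteqP; split => w h i hi; first by case: i hi => // i hi; exact: h.
exact: (h i.+1).
Qed.

(** A rectangle padded to length [n + m] only has its first [n] factors permuted, which leaves the
    product unchanged. *)
Lemma prefix_rev_preserving n B : measurable B -> P (prefix_rev n @^-1` B) = P B.
Proof.
apply: preserving_of_rect; first exact: measurable_prefix_rev.
move=> m A mA; rewrite (rect_pad A (leq_addl n m)).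
set A' := fun i => if _ then _ else _.
have mA' : forall i, measurable (A' i) by exact: measurable_pad.
rewrite (_ : prefix_rev n @^-1` _ = rect (n + m) (fun i => if (i < n)%N then A' (n - i.+1)%N else A' i)).
  rewrite !P_rect; [|exact: mA'|by move=> i; case: ifP].
  congr (_%:E); rewrite !big_split_ord/=; congr (_ * _).
    rewrite [RHS](reindex_inj rev_ord_inj); apply: eq_bigr => i _ /=.
    by rewrite ltn_ord.
  by apply: eq_bigr => i _; rewrite (ltnNge (n + i) n) leq_addr.
apply/seteqP; split => w h i hi.
  case: ifP => ni; last by have := h i hi; rewrite /prefix_rev ni.
  have := h (n - i.+1)%N; rewrite /prefix_rev.
  have -> : (n - i.+1 < n)%N by rewrite ltn_subrL (leq_ltn_trans _ ni).
  rewrite (_ : n - (n - i.+1).+1 = i)%N; last by rewrite subnSK// subKn// ltnW.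
  apply.
  by rewrite ltn_addr// ltn_subrL (leq_ltn_trans _ ni).
rewrite /prefix_rev; case: ifP => ni; last by have := h i hi; rewrite ni.
have := h (n - i.+1)%N.
have -> : (n - i.+1 < n)%N by rewrite ltn_subrL (leq_ltn_trans _ ni).
rewrite (_ : n - (n - i.+1).+1 = i)%N; last by rewrite subnSK// subKn// ltnW.
apply.
by rewrite ltn_addr// ltn_subrL (leq_ltn_trans _ ni).
Qed.

Lemma iter_shift n w k : iter n shift w k = w (n + k)%N.
Proof. by elim: n k => //= n IH k; rewrite /shift IH addnS. Qed.

Lemma measurable_iter_shift n : measurable_fun setT (iter n shift).
Proof. by apply: measurable_iter; exact: measurable_shift. Qed.

Lemma iter_shift_preserving n B : measurable B -> P (iter n shift @^-1` B) = P B.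
Proof. exact: (iter_preserving measurable_shift shift_preserving). Qed.

(** For a fixed rectangle both sides are finite measures in [B], and they agree on rectangles. *)
Lemma rect_shift_indep n A B : (forall i, measurable (A i)) -> measurable B ->
  P (iter n shift @^-1` B `&` rect n A) = (P (rect n A) * P B)%E.
Proof.
move=> mA mB; have mR := measurable_rect n mA.
have f0 : 0 <= fine (P (rect n A)) by rewrite fine_ge0.
have fin : P (rect n A) \is a fin_num by rewrite fin_num_measure.
have := @rect_measure_unique
  (measure_function_pushforward__canonical__measure_function_Measure (mrestr P mR) (measurable_iter_shift n))
  (mscale (NngNum f0) P) _ _ B mB.
rewrite /= /pushforward /mrestr /mscale /= fineK//; apply.
- move=> m A' mA'.
  rewrite (_ : _ `&` _ = rect (n + m) (fun i => if (i < n)%N then A i else A' (i - n)%N)).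
    rewrite !P_rect//; last by move=> i; case: ifP.
    rewrite -EFinM; congr (_%:E); rewrite big_split_ord/=; congr (_ * _).
      by apply: eq_bigr => i _; rewrite ltn_ord.
    by apply: eq_bigr => i _; rewrite ltnNge leq_addr /= addKn.
  apply/seteqP; split => w.
    move=> [h1 h2] i hi; case: ifP => [/h2 //|/negbT]; rewrite -leqNgt => ni.
    have := h1 (i - n)%N; rewrite iter_shift subnKC// ltn_subLR//; exact.
  move=> h; split=> i hi.
    by have := h (n + i)%N; rewrite ltn_add2l iter_shift (ltnNge (n + i) n) leq_addr /= addKn; apply.
  by have := h i (ltn_addr _ hi); rewrite hi.
- by rewrite preimage_setT setTI ltey_eq fin.
Qed.

(** [B] is contained in its preimages under iterates of the [m]-fold shift and has the same measure,
    so it agrees with them up to null sets. Hence [B] is independent of every rectangle, thus of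
    itself, and [P B = P B * P B]. *)
Lemma zero_one m B : (0 < m)%N -> measurable B -> B `<=` iter m shift @^-1` B ->
  P B = 0%E \/ P B = 1%E.
Proof.
move=> m0 mB hB.
have hBj j : B `<=` iter (j * m) shift @^-1` B.
  elim: j => [|j IH] w // /IH /= /hB /=; rewrite mulSn.
  by rewrite iterD.
have finB : P B \is a fin_num by rewrite fin_num_measure.
have f0 : 0 <= fine (P B) by rewrite fine_ge0.
have key n A : (forall i, measurable (A i)) -> P (rect n A `&` B) = (P B * P (rect n A))%E.
  (* A multiple of [m], so that [B] is contained in its preimage, and at least [n], so that this
     preimage is independent of the rectangle. *)
  move=> mA; pose N := (n * m)%N.
  have nN : (n <= N)%N by rewrite leq_pmulr.
  have mR := measurable_rect n mA.
  pose B' := iter N shift @^-1` B.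
  have mB' : measurable B' by rewrite -[X in measurable X]setTI; exact: measurable_iter_shift.
  have PB' : P B' = P B by exact: iter_shift_preserving.
  have null : P (B' `\` B) = 0%E.
    have E : (P (B' `\` B) = P B' - P (B' `&` B))%E.
      by rewrite measureD// ltey_eq fin_num_measure.
    by rewrite E (setIidr (hBj n)) PB' subee.
  transitivity (P (B' `&` rect n A)).
    apply/eqP; rewrite eq_le; apply/andP; split.
      rewrite le_measure ?inE; [|exact: measurableI|exact: measurableI|].
        by [].
      by move=> w [h1 h2]; split=> //; exact: hBj.
    have : B' `&` rect n A `<=` (rect n A `&` B) `|` (B' `\` B).
      by move=> w [h1 h2]; have [h|h] := pselect (B w); [left|right].
    move=> hs; apply: (@le_trans _ _ (P ((rect n A `&` B) `|` (B' `\` B)))).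
      rewrite le_measure ?inE//; first exact: measurableI.
      by apply: measurableU; [exact: measurableI|exact: measurableD].
    have : (P ((rect n A `&` B) `|` (B' `\` B)) <= P (rect n A `&` B) + P (B' `\` B))%E.
      by apply: measureU2; [exact: measurableI|exact: measurableD].
    by rewrite null adde0.
  rewrite (rect_pad A nN) muleC; apply: (@rect_shift_indep N _ B _ mB).
  exact: measurable_pad.
have := @rect_measure_unique (mrestr P mB) (mscale (NngNum f0) P) _ _ B mB.
rewrite /= /mrestr /mscale /= fineK// setIid => h.
have {}h : P B = (P B * P B)%E.
  apply: h; first exact: key.
  by rewrite setTI -(fineK finB) ltry.
move: h; rewrite -(fineK finB) -EFinM => -[] h.
have : fine (P B) * (1 - fine (P B)) == 0 by rewrite mulrBr mulr1 -h subrr.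
by rewrite mulf_eq0 subr_eq0 => /orP[/eqP->|/eqP<-]; [left|right].
Qed.

Lemma integral_coord0 (f : Diff1t tau -> \bar R) : measurable_fun setT f -> (forall x, 0 <= f x)%E ->
  (\int[P]_w f (w 0%N) = \int[nu]_x f x)%E.
Proof.
move=> mf f0; apply: ge0_integral_preserving => //; first exact: measurable_coord.
move=> A mA; rewrite (_ : _ @^-1` A = rect 1 (fun=> A)).
  by have := @P_rect 1 (fun=> A) (fun=> mA); rewrite big_ord1 fineK// fin_num_measure.
apply/seteqP; split => w /=; first by move=> h [].
by move=> /(_ 0%N isT).
Qed.

End product_space.

(** * Extremal exponents *)

Section sup_log_derivative.
Context {R : realType}.
Implicit Types (F G : R -> R) (x y e : R).

(* For [e = 1] and [e = -1] this is [log sup |F'|] and [- log inf |F'|]; treating both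
   signs at once makes the two extremal exponents instances of one statement. *)
Definition sup_logd e F : R := sup [set e * logd F x | x in [set: R]].

Lemma sup_logd_has_ubound e F : c1_lift F -> has_ubound [set e * logd F x | x in [set: R]].
Proof.
move=> /logd_bounded[C hC]; exists (`|e| * C) => _ [x _ <-].
by rewrite (le_trans (ler_norm _))// normrM ler_wpM2l.
Qed.

Lemma sup_logd_ge e F x : c1_lift F -> e * logd F x <= sup_logd e F.
Proof. by move=> hF; apply: (ub_le_sup (sup_logd_has_ubound e hF)); exists x. Qed.

Lemma sup_logd_le e F B : (forall x, e * logd F x <= B) -> sup_logd e F <= B.
Proof.
move=> h; apply: ge_sup; first by exists (e * logd F 0), 0.
by move=> _ [x _ <-].
Qed.

Lemma sup_logd_ge0 e F : c1_lift F -> 0 <= sup_logd e F.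
Proof.
by move=> hF; have [x x0] := logd_root hF; have := sup_logd_ge e x hF; rewrite x0 mulr0.
Qed.

Lemma sup_logd_comp e F G : c1_lift F -> c1_lift G -> sup_logd e (F \o G) <= sup_logd e F + sup_logd e G.
Proof.
move=> hF hG; apply: sup_logd_le => x; rewrite logd_comp// mulrDr.
by apply: lerD; exact: sup_logd_ge.
Qed.

Lemma sup_logd_id e : sup_logd e (@id R) = 0.
Proof.
apply: le_anti; rewrite sup_logd_ge0 ?andbT; last exact: c1_lift_id.
by apply: sup_logd_le => x; rewrite logd_id mulr0.
Qed.

(** The log derivatives of [F] at a point and of its inverse at the image are opposite, so inversion
    exchanges the two extremes. *)
Lemma sup_logd_finv e F : c1_lift F -> sup_logd e (Defs.finv F) = sup_logd (- e) F.
Proof.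
move=> hF; apply: le_anti; apply/andP; split; apply: sup_logd_le => x.
  by rewrite logd_finv// mulrN -mulNr; exact: sup_logd_ge.
have -> : - e * logd F x = e * logd (Defs.finv F) (F x).
  by rewrite logd_finv// Kfinv// mulrN mulNr.
by apply: sup_logd_ge; exact: c1_lift_finv.
Qed.

Lemma sup_logd_inverse e F G : c1_lift F -> cancel G F -> sup_logd e G = sup_logd (- e) F.
Proof.
move=> hF GK; have -> : G = Defs.finv F; last exact: sup_logd_finv.
by apply/funext => y; apply: (c1_lift_inj hF); rewrite GK finvK.
Qed.

Lemma derive1_norm_le F x : c1_lift F -> `|derive1 F x| <= expR (sup_logd 1 F).
Proof.
by move=> hF; rewrite -expR_logd// ler_expR; have := sup_logd_ge 1 x hF; rewrite mul1r.
Qed.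

Lemma derive1_norm_ge F x : c1_lift F -> expR (- sup_logd (-1) F) <= `|derive1 F x|.
Proof.
by move=> hF; rewrite -expR_logd// ler_expR; have := sup_logd_ge (-1) x hF; rewrite mulN1r lerNl.
Qed.

Lemma ln_supder F : c1_lift F -> ln (supder F) = sup_logd 1 F.
Proof.
move=> hF; have nF x : 0 < `|derive1 F x| by rewrite normr_gt0; case: hF.
have ub : has_ubound [set `|derive1 F z| | z in [set: R]].
  by exists (expR (sup_logd 1 F)) => _ [x _ <-]; exact: derive1_norm_le.
have le x : `|derive1 F x| <= supder F by apply: (ub_le_sup ub); exists x.
have s0 : 0 < supder F := lt_le_trans (nF 0) (le 0).
apply: le_anti; apply/andP; split.
  rewrite -[leRHS]expRK ler_ln ?posrE ?expR_gt0//.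
  apply: ge_sup; first by exists `|derive1 F 0|, 0.
  by move=> _ [x _ <-]; exact: derive1_norm_le.
by apply: sup_logd_le => x; rewrite mul1r /logd ler_ln ?posrE.
Qed.

Lemma ln_infder F : c1_lift F -> ln (infder F) = - sup_logd (-1) F.
Proof.
move=> hF; have nF x : 0 < `|derive1 F x| by rewrite normr_gt0; case: hF.
have lb : has_lbound [set `|derive1 F z| | z in [set: R]].
  by exists (expR (- sup_logd (-1) F)) => _ [x _ <-]; exact: derive1_norm_ge.
have le x : infder F <= `|derive1 F x| by apply: (ge_inf lb); exists x.
have ge : expR (- sup_logd (-1) F) <= infder F.
  apply: lb_le_inf; first by exists `|derive1 F 0|, 0.
  by move=> _ [x _ <-]; exact: derive1_norm_ge.
have i0 : 0 < infder F := lt_le_trans (expR_gt0 _) ge.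
apply: le_anti; apply/andP; split; last first.
  by rewrite -[leLHS]expRK ler_ln ?posrE ?expR_gt0.
rewrite lerNr; apply: sup_logd_le => x.
by rewrite mulN1r lerN2 /logd ler_ln ?posrE.
Qed.

(** Reduces uncountable suprema to countable intersections in the measurability proofs. *)
Lemma rat_dense_le (h : R -> R) (O : set R) (a : R) : continuous h -> open O ->
  (forall q : rat, O (ratr q) -> h (ratr q) <= a) -> forall x, O x -> h x <= a.
Proof.
move=> ch oO hq x Ox; rewrite leNgt; apply/negP => ahx.
have [||y [[Oy ay] [q _ qy]]] := @dense_rat R (O `&` h @^-1` [set y | a < y]).
- by exists x.
- apply: openI => //; apply: open_comp; [by move=> y _; exact: ch|exact: open_gt].
by move: (hq q); rewrite qy leNgt ay => /(_ Oy).
Qed.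

Lemma unit_cluster (u : nat -> R) : (forall n, 0 <= u n <= 1) ->
  exists x, forall O, nbhs x O -> forall N, exists2 n, (N <= n)%N & O (u n).
Proof.
move=> u01.
have [|x [_ hx]] := @segment_compact R 0 1 (u @ \oo) _.
  by exists 0%N => // n _; rewrite /= in_itv /=.
exists x => O nO N.
have [|_ [[n Nn <-] Oun]] := hx [set u n | n in [set n | (N <= n)%N]] O _ nO.
  by exists N => // n /= Nn; exists n.
by exists n.
Qed.

Lemma logd_frac F x y : c1_lift F ->
  logd F (y - (Num.floor x)%:~R) = logd F y.
Proof. by move=> hF; rewrite -mulrNz logd_int. Qed.

(** A sequence of violating pairs is moved so that first points lie in [[0, 1]], both points of a
    pair by the same integer to keep their difference; a cluster point contradicts continuity. *)
Lemma logd_unif_continuous F (e : R) : c1_lift F -> 0 < e ->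
  exists k : nat, forall x y, `|x - y| < k.+1%:R^-1 -> `|logd F x - logd F y| <= e.
Proof.
move=> hF e0; apply: contrapT => /forallNP h.
have /choice[uv huv] : forall k : nat, exists p : R * R,
    `|p.1 - p.2| < k.+1%:R^-1 /\ e < `|logd F p.1 - logd F p.2|.
  move=> k; have /existsNP[x /existsNP[y /not_implyP[xy /negP]]] := h k.
  by rewrite -ltNge => exy; exists (x, y).
pose u k := (uv k).1 - (Num.floor (uv k).1)%:~R.
pose v k := (uv k).2 - (Num.floor (uv k).1)%:~R.
have [|z hz] := @unit_cluster u.
  by move=> n; have /andP[h1 h2] := frac_itv (uv n).1; rewrite /u -/(Defs.frac _) h1 ltW.
have e2 : 0 < e / 2 by rewrite divr_gt0.
have /cvgrPdist_lt/(_ _ e2) : logd F @ z --> logd F z by exact: logd_continuous.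
move=> /nbhs_ballP[d /= d0 hd].
have d2 : 0 < d / 2 by rewrite divr_gt0.
have [n Nn hn] := hz _ (nbhsx_ballx z _ d2) (Num.truncn (d / 2)^-1).+1.
have [h1 h2] := huv n.
have nd : n.+1%:R^-1 < d / 2.
  rewrite -[ltRHS]invrK ltf_pV2 ?posrE ?invr_gt0//.
  by apply: (lt_le_trans (truncnS_gt _)); rewrite ler_nat leqW.
have huvn : `|u n - v n| < d / 2.
  by apply: lt_trans nd; rewrite /u /v opprB addrA subrK.
rewrite /ball /= in hn.
have hu : `|logd F z - logd F (u n)| < e / 2.
  by apply: hd; rewrite /ball /=; lra.
have hv : `|logd F z - logd F (v n)| < e / 2.
  apply: hd; rewrite /ball /=; apply: (le_lt_trans (ler_distD (u n) _ _)); lra.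
move: h2; rewrite -(logd_frac (uv n).1 (uv n).1 hF) -(logd_frac (uv n).1 (uv n).2 hF) -/(u n) -/(v n).
apply/negP; rewrite -leNgt (le_trans (ler_distD (logd F z) _ _))//.
rewrite (distrC _ (logd F z)); lra.
Qed.

(** Modulus of continuity at scale [1/(k+1)]. With a base point and an increment as parameters, the
    constraint bears on the increment alone, and each can be restricted to rationals in turn. *)
Definition logd_modulus F (k : nat) : R :=
  sup [set r | exists x t, `|t| < k.+1%:R^-1 /\ r = `|logd F (x + t) - logd F x|].

Lemma logd_modulus_le F k B : (forall x t, `|t| < k.+1%:R^-1 -> `|logd F (x + t) - logd F x| <= B) ->
  logd_modulus F k <= B.
Proof.
move=> h; apply: ge_sup; last by move=> _ [x [t [tk ->]]]; exact: h.
by exists `|logd F (0 + 0) - logd F 0|, 0, 0; rewrite normr0 invr_gt0.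
Qed.

Lemma logd_dist_le F x y : c1_lift F -> `|logd F x - logd F y| <= sup_logd 1 F + sup_logd (-1) F.
Proof.
move=> hF; have := sup_logd_ge 1 x hF; have := sup_logd_ge 1 y hF.
have := sup_logd_ge (-1) x hF; have := sup_logd_ge (-1) y hF.
by rewrite !mul1r !mulN1r ler_norml => *; apply/andP; split; lra.
Qed.

Lemma logd_modulus_ge F k x y : c1_lift F -> `|x - y| < k.+1%:R^-1 ->
  `|logd F x - logd F y| <= logd_modulus F k.
Proof.
move=> hF xy; apply: ub_le_sup; last first.
  by exists y, (x - y); have -> : y + (x - y) = x by rewrite addrC subrK.
by exists (sup_logd 1 F + sup_logd (-1) F) => _ [z [t [_ ->]]]; exact: logd_dist_le.
Qed.

Context {d : measure_display} {T : measurableType d}.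
Variable F_ : T -> R -> R.
Hypothesis hF : forall w, c1_lift (F_ w).
Hypothesis mF : forall x, measurable_fun setT (fun w => logd (F_ w) x).

Lemma measurable_sup_logd e : measurable_fun setT (fun w => sup_logd e (F_ w)).
Proof.
apply: measurable_of_le => a.
rewrite (_ : [set w | _] = \bigcap_(q in [set: rat]) [set w | e * logd (F_ w) (ratr q) <= a]).
  by apply: measurable_bigcap_rat => q; apply/measurable_le/measurable_funM.
apply/seteqP; split => w /= h.
  by move=> q _ /=; apply: le_trans h; exact: sup_logd_ge.
apply: sup_logd_le => x; apply: (@rat_dense_le (fun x => e * logd (F_ w) x) setT) => //.
- by move=> y; apply: cvgMr; exact: logd_continuous.
- exact: openT.
Qed.

Lemma measurable_logd_modulus k : measurable_fun setT (fun w => logd_modulus (F_ w) k).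
Proof.
apply: measurable_of_le => a.
rewrite (_ : [set w | _] = \bigcap_(q in [set: rat]) \bigcap_(p in [set: rat])
  if `|ratr q| < k.+1%:R^-1 :> R then
    [set w | `|logd (F_ w) (ratr p + ratr q) - logd (F_ w) (ratr p)| <= a] else setT).
  apply: measurable_bigcap_rat => q; apply: measurable_bigcap_rat => p.
  case: ifP => _ //; apply: measurable_le.
  by apply: measurableT_comp; [exact: normr_measurable|exact: measurable_funB].
apply/seteqP; split => w /= h.
  move=> q _ p _; case: ifP => // hq; apply: le_trans h.
  by apply: logd_modulus_ge => //; rewrite addrC addKr.
have cL := logd_continuous (hF w).
apply: logd_modulus_le => x t ht.
apply: (@rat_dense_le (fun t => `|logd (F_ w) (x + t) - logd (F_ w) x|) [set t : R | `|t| < k.+1%:R^-1]) => //.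
- move=> y; apply: (@continuous_comp _ _ _ (fun t => logd (F_ w) (x + t) - logd (F_ w) x)
    (fun y : R => `|y|)); last exact: norm_continuous.
  apply: (@continuousB _ _ _ (fun t => logd (F_ w) (x + t)) (cst _)); last exact: cst_continuous.
  apply: (@continuous_comp _ _ _ (fun t => x + t) (logd (F_ w))); last exact: cL.
  by apply: (@continuousD _ _ _ (cst x) id); [exact: cst_continuous|exact: id].
- rewrite (_ : [set t : R | _] = (fun y : R => `|y|) @^-1` [set y | y < k.+1%:R^-1])//.
  by apply: open_comp; [move=> y _; exact: norm_continuous|exact: open_lt].
move=> q hq; apply: (@rat_dense_le (fun x => `|logd (F_ w) (x + ratr q) - logd (F_ w) x|) setT) => //.
- move=> y; apply: (@continuous_comp _ _ _ (fun x => logd (F_ w) (x + ratr q) - logd (F_ w) x)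
    (fun y : R => `|y|)); last exact: norm_continuous.
  apply: (@continuousB _ _ _ (fun x => logd (F_ w) (x + ratr q)) (logd (F_ w))); last exact: cL.
  apply: (@continuous_comp _ _ _ (fun x => x + ratr q) (logd (F_ w))); last exact: cL.
  by apply: cvgD; [exact: cvg_id|exact: cvg_cst].
- exact: openT.
- by move=> p _; have := h q I p I; rewrite /= hq.
Qed.

End sup_log_derivative.

Section walk_lemmas.
Context {R : realType}.
Implicit Types (g h : nat -> R -> R).

Lemma walk_ext g h n : (forall k, (k < n)%N -> g k = h k) -> walk g n = walk h n.
Proof.
elim: n => //= n IH gh; rewrite gh// IH// => k kn; exact/gh/ltnW.
Qed.

Lemma walk_add g i j : walk g (i + j) = walk (fun k => g (i + k)%N) j \o walk g i.
Proof.
elim: j => [|j IH]; first by rewrite addn0.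
by rewrite addnS /= IH.
Qed.

Lemma rwalk_rev g n : rwalk g n = walk (fun k => g (n - k.+1)%N) n.
Proof.
elim: n => // n IH; rewrite [LHS]/= IH.
have E := walk_add (fun k => g (n.+1 - k.+1)%N) 1 n; rewrite add1n in E.
by rewrite E /= subSS subn0.
Qed.

End walk_lemmas.

Lemma ae_forall_nat {R : realType} {d} {T : measurableType d}
    (P : {measure set T -> \bar R}) (Q : nat -> T -> Prop) :
  (forall k, \forall w \ae P, Q k w) -> \forall w \ae P, forall k, Q k w.
Proof.
move=> h; rewrite /almost_everywhere /= .
have := negligible_bigcup h; apply: negligibleS => w /= /existsNP[k hk].
by exists k.
Qed.

Lemma ae_and {R : realType} {d} {T : measurableType d}
    (P : {measure set T -> \bar R}) (Q1 Q2 : T -> Prop) :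
  (\forall w \ae P, Q1 w) -> (\forall w \ae P, Q2 w) -> \forall w \ae P, Q1 w /\ Q2 w.
Proof.
move=> h1 h2; have := negligibleU h1 h2; apply: negligibleS => w /= /not_andP[]; by [left|right].
Qed.

Lemma ae_imply {R : realType} {d} {T : measurableType d}
    (P : {measure set T -> \bar R}) (Q1 Q2 : T -> Prop) :
  (\forall w \ae P, Q1 w) -> (forall w, Q1 w -> Q2 w) -> \forall w \ae P, Q2 w.
Proof. by move=> h1 h; apply: negligibleS h1 => w /= + /h. Qed.

(** * Random walks with steps [G (w k)], for [G f] the lift of [f] or its inverse *)

Section random_walk.
Context {R : realType} (tau : R).
Variables (nu : probability (Diff1t tau) R) (P : probability (DiffN tau) R).
Hypothesis hP : is_product_measure nu P.
Variable G : Diff1t tau -> R -> R.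
Hypothesis cG : forall f, c1_lift (G f).
Hypothesis mG : forall x, measurable_fun setT (fun f => G f x).
Hypothesis mlG : forall x, measurable_fun setT (fun f => logd (G f) x).
Implicit Types (w : DiffN tau) (x e q : R).

Definition steps w (k : nat) : R -> R := G (w k).
Let S n w x := logd (walk (steps w) n) x.
Let W e n w := sup_logd e (walk (steps w) n).

Lemma c1_lift_steps_walk n w : c1_lift (walk (steps w) n).
Proof. by apply: c1_lift_walk => k; exact: cG. Qed.

Lemma steps_shift i w : steps (iter i shift w) = fun k => steps w (i + k)%N.
Proof. by apply/funext => k; rewrite /steps iter_shift. Qed.

Lemma logd_walk_add i j w x :
  S (i + j) w x = S i w x + S j (iter i shift w) (walk (steps w) i x).
Proof.
rewrite /S walk_add -steps_shift logd_comp; [|exact: c1_lift_steps_walk..].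
by rewrite addrC.
Qed.

Lemma measurable_walk n x : measurable_fun setT (fun w => walk (steps w) n x).
Proof.
elim: n x => [|n IH] x; first exact: measurable_cst.
apply: (@caratheodory_measurable _ _ _ (fun w => G (w n)) (fun w => walk (steps w) n x)).
- move=> y; apply: (@measurableT_comp _ _ _ _ _ _ (fun f : Diff1t tau => G f y)) => //.
  exact: measurable_coord.
- by move=> w; apply: c1_lift_continuous; exact: cG.
- exact: IH.
Qed.

Lemma measurable_logd_walk n x : measurable_fun setT (fun w => S n w x).
Proof.
elim: n => [|n IH].
  rewrite (_ : (fun w => _) = cst 0); first exact: measurable_cst.
  by apply/funext => w; rewrite /S /= logd_id.
rewrite (_ : (fun w => _) = (fun w => logd (G (w n)) (walk (steps w) n x) + S n w x)); last first.
  by apply/funext => w; rewrite /S logd_walkS// => k; exact: cG.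
apply: measurable_funD => //.
apply: (@caratheodory_measurable _ _ _ (fun w => logd (G (w n))) (fun w => walk (steps w) n x)).
- move=> y; apply: (@measurableT_comp _ _ _ _ _ _ (fun f : Diff1t tau => logd (G f) y)) => //.
  exact: measurable_coord.
- by move=> w; apply: logd_continuous; exact: cG.
- exact: measurable_walk.
Qed.

Lemma measurable_sup_walk e n : measurable_fun setT (W e n).
Proof.
apply: (measurable_sup_logd (F_ := fun w => walk (steps w) n)).
- by move=> w; exact: c1_lift_steps_walk.
- exact: measurable_logd_walk.
Qed.

Lemma sup_walk_ge0 e n w : 0 <= W e n w.
Proof. exact/sup_logd_ge0/c1_lift_steps_walk. Qed.

Lemma sup_walk_ge e n w x : e * S n w x <= W e n w.
Proof. exact/sup_logd_ge/c1_lift_steps_walk. Qed.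

Lemma sup_walk0 e w : W e 0 w = 0.
Proof. exact: sup_logd_id. Qed.

Lemma sup_walk_subadditive e i j w : W e (i + j) w <= W e i w + W e j (iter i shift w).
Proof.
by rewrite /W walk_add -steps_shift addrC; apply: sup_logd_comp; exact: c1_lift_steps_walk.
Qed.

Lemma integral_sup_walk1 e : (\int[P]_w (W e 1 w)%:E = \int[nu]_f (sup_logd e (G f))%:E)%E.
Proof.
rewrite -(integral_coord0 hP (f := fun f => (sup_logd e (G f))%:E)).
- by [].
- by apply/measurable_EFinP; exact: measurable_sup_logd.
- by move=> f; rewrite lee_fin; exact: sup_logd_ge0.
Qed.

Definition mean_sup_walk e n : R := fine (\int[P]_w (W e n w)%:E)%E.
(* By subadditivity the infimum is also the limit of these means; only the infimum is
   needed. *)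
Definition exponent e : R := inf [set mean_sup_walk e n.+1 / n.+1%:R | n in [set: nat]].

Let shP := shift_preserving hP.
Let msh := @measurable_shift R tau.

Lemma shift_zero_one B : measurable B -> B `<=` @shift R tau @^-1` B -> P B = 0%E \/ P B = 1%E.
Proof. exact: (zero_one hP (ltn0Sn 0)). Qed.

Section one_sign.
Variable e : R.
Hypothesis hY : (\int[nu]_f (sup_logd e (G f))%:E < +oo)%E.

Lemma sup_walk_fin n : (\int[P]_w (W e n w)%:E)%E \is a fin_num.
Proof.
rewrite ge0_fin_numE; last by apply: integral_ge0 => w _; rewrite lee_fin sup_walk_ge0.
apply: (@le_lt_trans _ _ (\int[P]_w (\sum_(0 <= i < n) W e 1 (iter i shift w))%:E)%E).
  apply: ge0_le_integral => //.
  - by move=> w _; rewrite lee_fin sup_walk_ge0.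
  - by apply/measurable_EFinP; exact: measurable_sup_walk.
  - apply/measurable_EFinP; apply: measurable_sum => i.
    by apply: measurableT_comp; [exact: measurable_sup_walk|exact: measurable_iter_shift].
  - move=> w _; rewrite lee_fin; elim: n => [|n IH]; first by rewrite sup_walk0 big_geq.
    by rewrite big_nat_recr//= -[in leLHS]addn1 (le_trans (sup_walk_subadditive _ _ _ _))// lerD2r.
rewrite (integral_sum_iter msh shP); [|exact: measurable_sup_walk|exact: sup_walk_ge0].
have : (\int[P]_w (W e 1 w)%:E)%E \is a fin_num.
  rewrite ge0_fin_numE; last by apply: integral_ge0 => w _; rewrite lee_fin sup_walk_ge0.
  by rewrite integral_sup_walk1.
by move=> h; rewrite -(fineK h) -EFinM ltry.
Qed.

Lemma mean_sup_walk_ge0 n : 0 <= mean_sup_walk e n.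
Proof. by rewrite fine_ge0// integral_ge0// => w _; rewrite lee_fin sup_walk_ge0. Qed.

Lemma exponent_ge0 : 0 <= exponent e.
Proof.
apply: lb_le_inf; first by exists (mean_sup_walk e 1 / 1), 0%N.
by move=> _ [n _ <-]; rewrite divr_ge0// mean_sup_walk_ge0.
Qed.

Lemma exponent_le n : n%:R * exponent e <= mean_sup_walk e n.
Proof.
case: n => [|n]; first by rewrite mul0r mean_sup_walk_ge0.
rewrite mulrC -ler_pdivlMr ?ltr0n//; apply: ge_inf; last by exists n.
by exists 0 => _ [m _ <-]; rewrite divr_ge0// mean_sup_walk_ge0.
Qed.

(** Since [exponent e] is an infimum, the mean rate over some [m+1] steps is already below [q], and
    the subadditive bound applies with that block length. *)
Lemma rate_upper q : exponent e < q ->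
  \forall w \ae P, exists C : R, forall n, W e n w <= n%:R * q + C.
Proof.
move=> Lq; have [||_ [m _ <-] mq] := @inf_lt R [set mean_sup_walk e n.+1 / n.+1%:R | n in [set: nat]] q.
- by exists (mean_sup_walk e 1 / 1), 0%N.
- exact: Lq.
apply: (@kingman_upper R _ _ P shift (W e) m.+1 q) => //.
- by move=> B; exact: (zero_one hP (ltn0Sn m)).
- by move=> n; exact: measurable_sup_walk.
- exact: sup_walk_ge0.
- exact: sup_walk0.
- exact: sup_walk_subadditive.
- by rewrite integral_sup_walk1.
- by rewrite -(fineK (sup_walk_fin m.+1)) lte_fin mulrC -ltr_pdivrMr ?ltr0n.
Qed.

(** The points [r N], good up to time [N], cluster modulo 1; each condition at a fixed time passes
    to the cluster point, with a large inequality in place of the strict one. *)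
Lemma uniform_rate_point (q : R) w (r : nat -> rat) :
  (forall N j, (0 < j <= N)%N -> 0 < e * S j w (ratr (r N)) - j%:R * q) ->
  exists x, forall j, (0 < j)%N -> j%:R * q <= e * S j w x.
Proof.
move=> hr; pose u N : R := Defs.frac (ratr (r N)).
have [|x hx] := @unit_cluster _ u.
  by move=> n; have /andP[h1 h2] := frac_itv (ratr (r n) : R); rewrite h1 ltW.
exists x => j j0; rewrite leNgt; apply/negP => h.
have [|N jN /=] := hx [set y | e * S j w y < j%:R * q] _ j.
  apply: open_nbhs_nbhs; split=> //.
  rewrite (_ : [set y | _] = (fun y => e * S j w y) @^-1` [set z | z < j%:R * q])//.
  apply: open_comp; last exact: open_lt.
  by move=> y _; apply: cvgMr; apply: logd_continuous; exact: c1_lift_steps_walk.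
rewrite /u /Defs.frac /S logd_frac; last exact: c1_lift_steps_walk.
have := hr N j; rewrite j0 jN subr_gt0 => /(_ isT) h1 h2.
by have := lt_trans h1 h2; rewrite ltxx.
Qed.

(* Otherwise almost every [w] admits for every [x] a time [n] with
   [e * S n w x <= n * q], and covering orbits by such blocks gives [exponent e <= q]. *)
Lemma rate_exists q : q < exponent e ->
  \forall w \ae P, exists x (C : R), forall n, n%:R * q - C <= e * S n w x.
Proof.
move=> qL.
(* The skew product: it moves the starting point by the first step while shifting [w]. *)
pose sk (p : DiffN tau * R) := (shift p.1, G (p.1 0%N) p.2).
pose a (p : DiffN tau * R) (n : nat) := e * S n p.1 p.2 - n%:R * q.
have iter_sk i p : iter i sk p = (iter i shift p.1, walk (steps p.1) i p.2).
  elim: i => [|i IH]; first by case: p.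
  by rewrite iterS IH /sk /= iter_shift addn0.
have aD p i j : a p (i + j)%N = a p i + a (iter i sk p) j.
  by rewrite /a iter_sk /= logd_walk_add natrD mulrDr mulrDl opprD addrACA.
pose y w := W e 1 w + `|q|.
have my : measurable_fun setT y by apply: measurable_funD => //; exact: measurable_sup_walk.
have y0 w : 0 <= y w by rewrite addr_ge0// sup_walk_ge0.
have yoo : (\int[P]_w (y w)%:E < +oo)%E.
  under eq_integral do rewrite EFinD.
  rewrite ge0_integralD//; last 2 first.
  - by move=> w _; rewrite lee_fin sup_walk_ge0.
  - by apply/measurable_EFinP; exact: measurable_sup_walk.
  by rewrite integral_const -(fineK (sup_walk_fin 1)) -EFinD ltry.
have ay p : a p 1%N <= y p.1.
  rewrite /a /y mul1r; apply: lerD; first exact: sup_walk_ge.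
  by rewrite -normrN ler_norm.
(* The bound [W e n w <= n q + B] is written with the negative and positive parts of [q] on opposite
   sides, so that both sides are nonnegative functions plus a constant. *)
pose U n w := W e n w + n%:R * Num.max (- q) 0.
pose V n (w : DiffN tau) := n%:R * Num.max q 0.
have qE : q = Num.max q 0 - Num.max (- q) 0.
  have [q0|q0] := leP 0 q; first by rewrite max_r ?oppr_le0// subr0.
  by rewrite max_l ?sub0r ?opprK// oppr_ge0 ltW.
have mU n : measurable_fun setT (U n) by apply: measurable_funD => //; exact: measurable_sup_walk.
have mV n : measurable_fun setT (V n) by exact: measurable_cst.
have U0 n w : 0 <= U n w by rewrite addr_ge0 ?sup_walk_ge0// mulr_ge0// le_max lexx orbT.
have V0 n w : 0 <= V n w by rewrite mulr_ge0// le_max lexx orbT.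
have UV n w (B : R) : (forall p : DiffN tau * R, p.1 = w -> a p n <= B) -> U n w <= V n w + B.
  move=> h; have : W e n w <= n%:R * q + B.
    by apply: sup_logd_le => x; have := h (w, x) erefl; rewrite /a /= lerBlDl.
  by rewrite {1}qE /U /V mulrBr; lra.
pose A N := \bigcap_(r in [set: rat])
  \bigcup_(j in [set j | (0 < j <= N)%N]) [set w | a (w, ratr r) j <= 0].
have mA N : measurable (A N).
  apply: measurable_bigcap_rat => r; apply: bigcup_measurable => j _.
  apply: measurable_le; apply: measurable_funB => //; apply: measurable_funM => //.
  exact: measurable_logd_walk.
have ndA : nondecreasing_seq A.
  apply/nondecreasing_seqP => N; rewrite subsetEset => w h r _.
  have [j /= /andP[j0 jN] hj] := h r I.
  by exists j => //=; rewrite j0 ltnW.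
have hA N (p : DiffN tau * R) : A N p.1 -> exists j, (0 < j <= N)%N /\ a p j <= 0.
  case: p => w x /= Aw; apply: contrapT => hn.
  have hx j : (0 < j <= N)%N -> 0 < a (w, x) j.
    by move=> jN; rewrite ltNge; apply/negP => aj; apply: hn; exists j.
  (* Positivity up to time [N] is an open condition on the starting point, so a real point
     satisfying it yields a rational one, against the definition of [A N]. *)
  pose O := [set y : R | forall i : 'I_N, 0 < a (w, y) i.+1].
  have nO : nbhs x O.
    apply: (@filter_forall R 'I_N (fun i y => 0 < a (w, y) i.+1) (nbhs x)) => i.
    apply: open_nbhs_nbhs; split; last first.
      by apply: hx; rewrite ltn0Sn ltn_ord.
    apply: (@open_comp _ _ (fun y => a (w, y) i.+1) [set z | 0 < z]); last exact: open_gt.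
    move=> z _; apply: cvgB; last exact: cvg_cst.
    by apply: cvgMr; apply: logd_continuous; exact: c1_lift_steps_walk.
  have [||z [Oz [r _ rz]]] := @dense_rat R (interior O).
  - by exists x.
  - exact: open_interior.
  have [j /= jN] := Aw r I; rewrite rz.
  case: j jN => // j /andP[_ jN]; rewrite leNgt => /negP; apply.
  exact: (interior_subset Oz (Ordinal jN)).
have [h|h] := @ergodic_alternative R _ _ P shift msh shP shift_zero_one
    (DiffN tau * R)%type sk fst a y U V (fun=> erefl) aD my y0 yoo ay mU mV U0 V0 UV A mA ndA hA.
  apply: filterS h => w [k hk].
  have /choice[r hr] : forall N : nat, exists r : rat, forall j, (0 < j <= N)%N ->
      0 < e * S j (iter k shift w) (ratr r) - j%:R * q.
    move=> N; apply: contrapT => /forallNP h; apply: hk; exists N => // r _.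
    have /existsNP[j /not_implyP[jN /negP]] := h r.
    by rewrite -leNgt => hj; exists j.
  have [x hx] := uniform_rate_point hr.
  (* The good point found for the sequence shifted by [k] is pulled back to time 0; the first [k]
     times enter the constant. *)
  pose x' := Defs.finv (walk (steps w) k) x.
  have x'E : walk (steps w) k x' = x by apply: finvK; exact: c1_lift_steps_walk.
  exists x', (\sum_(0 <= i < k.+1) `|a (w, x') i|) => n.
  have hC i : (i <= k)%N -> - \sum_(0 <= i < k.+1) `|a (w, x') i| <= a (w, x') i.
    move=> ik; rewrite lerNl; apply: (@le_trans _ _ `|a (w, x') i|).
      by rewrite -normrN ler_norm.
    by rewrite big_mkord (bigD1 (Ordinal (ltnSE ik : (i < k.+1)%N)))//= lerDl sumr_ge0.
  suff : - \sum_(0 <= i < k.+1) `|a (w, x') i| <= a (w, x') n.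
    by rewrite {2}/a /=; lra.
  have [nk|kn] := leqP n k; first exact: hC.
  rewrite -(subnKC (ltnW kn)) aD; apply: (le_trans (hC k (leqnn k))).
  rewrite lerDl iter_sk /a /= x'E subr_ge0; apply: hx.
  by rewrite subn_gt0.
(* In the second alternative the means of [W e n] grow at a rate below [exponent e], against
   [exponent_le]. *)
exfalso; have [|C hC] := h ((exponent e - q) / 2); first by rewrite divr_gt0// subr_gt0.
apply: (@rate_conflict R (fun n => n%:R * exponent e) (exponent e) (q + (exponent e - q) / 2) 0 C).
- lra.
- by move=> n; rewrite subr0.
move=> n; apply: (le_trans (exponent_le n)); have := hC n.
under eq_integral do rewrite EFinD.
rewrite ge0_integralD//; last 3 first.
- by move=> w _; rewrite lee_fin sup_walk_ge0.
- by apply/measurable_EFinP; exact: measurable_sup_walk.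
- by move=> w _; rewrite lee_fin mulr_ge0// le_max lexx orbT.
rewrite !integral_const -(fineK (sup_walk_fin n)) -!EFinD lee_fin -/(mean_sup_walk e n) => h1.
have : n%:R * q = n%:R * Num.max q 0 - n%:R * Num.max (- q) 0 by rewrite {1}qE mulrBr.
lra.
Qed.

End one_sign.

Hypothesis hYp : (\int[nu]_f (sup_logd 1 (G f))%:E < +oo)%E.
Hypothesis hYm : (\int[nu]_f (sup_logd (-1) (G f))%:E < +oo)%E.

(** The modulus of one step tends to 0 with the scale, by uniform continuity, and is dominated by
    the integrable [Y]. So at a fine scale its mean is at most [e/4 + e/4 < e], and [birkhoff_upper]
    bounds its sums along the orbit. *)
Lemma modulus_average (e : R) : 0 < e -> \forall w \ae P, exists d : R, 0 < d /\ exists mu : nat -> R,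
  (forall i x y, `|x - y| < d -> `|logd (steps w i) x - logd (steps w i) y| <= mu i) /\
  exists C : R, forall n, \sum_(i < n) mu i <= n%:R * e + C.
Proof.
move=> e0; have e4 : 0 < e / 4 by rewrite divr_gt0.
pose M k w := logd_modulus (G (w 0%N)) k.
have mM k : measurable_fun setT (M k).
  apply: (@measurable_logd_modulus R _ _ (fun w => G (w 0%N))) => // x.
  apply: (@measurableT_comp _ _ _ _ _ _ (fun f : Diff1t tau => logd (G f) x)) => //.
  exact: measurable_coord.
pose Y w := W 1 1 w + W (-1) 1 w.
have mY : measurable_fun setT Y by apply: measurable_funD; exact: measurable_sup_walk.
have Y0 w : 0 <= Y w by rewrite addr_ge0// sup_walk_ge0.
have Yoo : (\int[P]_w (Y w)%:E < +oo)%E.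
  under eq_integral do rewrite EFinD.
  rewrite ge0_integralD//; last 4 first.
  - by move=> w _; rewrite lee_fin sup_walk_ge0.
  - by apply/measurable_EFinP; exact: measurable_sup_walk.
  - by move=> w _; rewrite lee_fin sup_walk_ge0.
  - by apply/measurable_EFinP; exact: measurable_sup_walk.
  by rewrite -(fineK (sup_walk_fin hYp 1)) -(fineK (sup_walk_fin hYm 1)) -EFinD ltry.
have M0 k w : 0 <= M k w.
  apply: le_trans (logd_modulus_ge (k := k) (x := 0) (y := 0) (cG (w 0%N)) _); first by [].
  by rewrite subrr normr0 invr_gt0.
have MY k w : M k w <= Y w by apply: logd_modulus_le => x t _; exact: logd_dist_le.
pose A k := [set w | M k w <= e / 4].
have [||||N hN] := @integral_tail_small _ _ _ P Y A (e / 4) mY Y0 Yoo.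
- by move=> k; exact: measurable_le.
- apply/nondecreasing_seqP => k; rewrite subsetEset => w /=; apply: le_trans.
  apply: logd_modulus_le => x t tk; apply: logd_modulus_ge => //.
  have -> : x + t - x = t by rewrite addrC addKr.
  apply: (lt_trans tk); by rewrite ltf_pV2 ?posrE// ltr_nat.
- rewrite (_ : \bigcup_N A N = setT) ?probability_setT//.
  apply/seteqP; split=> // w _; have [k hk] := logd_unif_continuous (cG (w 0%N)) e4.
  exists k => //=; apply: logd_modulus_le => x t tk; apply: hk.
  by have -> : x + t - x = t by rewrite addrC addKr.
- exact: e4.
have mI : measurable_fun setT (fun w => Y w * \1_(~` A N) w).
  by apply: measurable_funM => //; apply/measurable_indic/measurableC/measurable_le.
have Me : (\int[P]_w (M N w)%:E < e%:E)%E.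
  apply: (@le_lt_trans _ _ (\int[P]_w ((e / 4)%:E + (Y w * \1_(~` A N) w)%:E))%E).
    apply: ge0_le_integral => //.
    - by move=> w _; rewrite lee_fin.
    - exact/measurable_EFinP.
    - by apply: emeasurable_funD => //; exact/measurable_EFinP.
    move=> w _; rewrite -EFinD lee_fin indicE.
    have [/set_mem _|/negP] := boolP (w \in ~` A N).
      by rewrite mulr1 (le_trans (MY _ _))// lerDr ltW.
    by rewrite inE => /contrapT /= h; rewrite mulr0 addr0.
  rewrite ge0_integralD//; last 3 first.
  - by move=> w _; rewrite lee_fin ltW.
  - by move=> w _; rewrite lee_fin mulr_ge0.
  - exact/measurable_EFinP.
  rewrite integral_const; apply: (@le_lt_trans _ _ ((e / 4)%:E + (e / 4)%:E)%E).
    by rewrite leeD2l.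
  by rewrite -EFinD lte_fin; lra.
have := birkhoff_upper msh shP shift_zero_one (mM N) (M0 N) Me.
apply: filterS => w [C hC]; exists N.+1%:R^-1; split; first by rewrite invr_gt0.
exists (fun i => logd_modulus (G (w i)) N); split; first by move=> i x y; apply: logd_modulus_ge; exact: cG.
exists C => n; apply: le_trans (hC n); rewrite big_mkord.
by apply: ler_sum => i _; rewrite /M iter_shift addn0.
Qed.

Variable H : Diff1t tau -> R -> R.
Hypothesis cH : forall f, c1_lift (H f).
Hypothesis GK : forall f, cancel (G f) (H f).
Hypothesis HK : forall f, cancel (H f) (G f).
Variable theta : DiffN tau -> R.
Hypothesis htheta : forall x, in_circle x -> \forall w \ae P,
  (fun n => cdist (rwalk (fun k => H (w k)) n x) (theta w)) @ \oo --> (0 : R).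

(** The almost sure facts are gathered only for tolerances [1/(k+1)] and grid points [i/(m+1)].
    These are countably many, so one null set serves all [x]; outside it the deterministic dichotomy
    applies. *)
Theorem walk_exponents : \forall w \ae P,
  (forall x, (fun n => n%:R^-1 * S n w x) @ \oo -->
    (if `[< forall z : int, x <> theta w + z%:~R >] then - exponent (-1) else exponent 1)) /\
  ((fun n => n%:R^-1 * W 1 n w) @ \oo --> exponent 1) /\
  ((fun n => n%:R^-1 * W (-1) n w) @ \oo --> exponent (-1)).
Proof.
have k0 (k : nat) : (0 : R) < k.+1%:R^-1 by rewrite invr_gt0.
have small (d : R) : 0 < d -> exists k : nat, k.+1%:R^-1 < d.
  move=> d0; exists (Num.truncn d^-1); rewrite -[ltRHS]invrK ltf_pV2 ?posrE ?invr_gt0//.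
  exact: truncnS_gt.
have up e : (\int[nu]_f (sup_logd e (G f))%:E < +oo)%E ->
    \forall w \ae P, forall k : nat, exists C : R, forall n, W e n w <= n%:R * (exponent e + k.+1%:R^-1) + C.
  by move=> hY; apply: ae_forall_nat => k; apply: rate_upper => //; rewrite ltrDl.
have ex e : (\int[nu]_f (sup_logd e (G f))%:E < +oo)%E ->
    \forall w \ae P, forall k : nat, exists x (C : R),
      forall n, n%:R * (exponent e - k.+1%:R^-1) - C <= e * S n w x.
  by move=> hY; apply: ae_forall_nat => k; apply: rate_exists => //; rewrite gtrBl.
have md : \forall w \ae P, forall k : nat, exists d : R, 0 < d /\ exists mu : nat -> R,
    (forall i x y, `|x - y| < d -> `|logd (steps w i) x - logd (steps w i) y| <= mu i) /\
    exists C : R, forall n, \sum_(i < n) mu i <= n%:R * k.+1%:R^-1 + C.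
  by apply: ae_forall_nat => k; exact: modulus_average.
have th : \forall w \ae P, forall m i : nat, (i < m.+1)%N ->
    (fun n => cdist (rwalk (fun k => H (w k)) n (i%:R / m.+1%:R)) (theta w)) @ \oo --> (0 : R).
  apply: ae_forall_nat => m; apply: ae_forall_nat => i.
  have [im|im] := ltnP i m.+1; last by apply: aeW => w.
  have ic : in_circle (i%:R / m.+1%:R : R).
    by rewrite /in_circle divr_ge0//= ltr_pdivrMr ?ltr0n// mul1r ltr_nat.
  have [N [mN N0 hN]] := htheta ic; exists N; split=> // w /= hw.
  by apply: hN => h; apply: hw.
have upp := up _ hYp; have upm := up _ hYm; have exp_ := ex _ hYp; have exm := ex _ hYm.
have all := ae_and (ae_and upp upm) (ae_and (ae_and exp_ exm) (ae_and md th)).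
refine (ae_imply all _) => w [[hup1 hup2] [[hex1 hex2] [hmd hth]]].
(* The lower bound for the supremum comes from the single point of nearly maximal growth. *)
have cv e : (forall k : nat, exists C : R, forall n, W e n w <= n%:R * (exponent e + k.+1%:R^-1) + C) ->
    (forall k : nat, exists x (C : R), forall n, n%:R * (exponent e - k.+1%:R^-1) - C <= e * S n w x) ->
    (fun n => n%:R^-1 * W e n w) @ \oo --> exponent e.
  move=> h1 h2; apply: rate_cvg => d /small[k kd].
    have [x [C hC]] := h2 k; exists C => n; apply: le_trans (sup_walk_ge e n w x).
    by apply: le_trans (hC n); rewrite lerD2r ler_wpM2l// lerD2l lerN2 ltW.
  have [C hC] := h1 k; exists C => n; apply: (le_trans (hC n)).
  by rewrite lerD2r ler_wpM2l// lerD2l ltW.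
split; last by split; exact: cv.
move=> x; apply: (@exponent_dichotomy R (steps w) (theta w)).
- by move=> k; exact: cG.
- move=> d /small[k kd]; have [d' [d'0 [mu [hmu [C hC]]]]] := hmd k.
  exists d'; split=> //; exists mu; split=> //; exists C => n; apply: (le_trans (hC n)).
  by rewrite lerD2r ler_wpM2l// ltW.
- move=> a b ta ab bt d /small[m md'].
  have [|||||N hN] := @walk_contract R (steps w) (fun k => H (w k)) (theta w) a b m _ _ _ _ _ ta ab bt.
  + by move=> k; exact: cG.
  + by move=> k; exact: cH.
  + by move=> k; exact: GK.
  + by move=> k; exact: HK.
  + by move=> i; exact: hth.
  by exists N => n x1 y1 Nn hx hy; apply: le_lt_trans md'; exact: hN.
- by rewrite oppr_le0; exact: exponent_ge0.
- exact: exponent_ge0.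
- move=> d /small[k kd]; have [C hC] := hup1 k; exists C => n y.
  have := sup_walk_ge 1 n w y; rewrite mul1r => /le_trans; apply; apply: (le_trans (hC n)).
  by rewrite lerD2r ler_wpM2l// lerD2l ltW.
- move=> d /small[k kd]; have [C hC] := hup2 k; exists C => n y.
  have := le_trans (sup_walk_ge (-1) n w y) (hC n); rewrite mulN1r => h1.
  have -> : n%:R * (- exponent (-1) - d) - C = - (n%:R * (exponent (-1) + d) + C).
    by rewrite -opprD mulrN opprD.
  rewrite lerNl; apply: (le_trans h1).
  by rewrite lerD2r ler_wpM2l// lerD2l ltW.
- move=> q qL; have [k kq] := small (exponent 1 - q) ltac:(by rewrite subr_gt0).
  have [y [C hC]] := hex1 k; exists y, C => n.
  have := hC n; rewrite mul1r; apply: le_trans.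
  by rewrite lerD2r ler_wpM2l// lerBrDl -lerBrDr ltW.
- move=> q qL; have [k kq] := small (exponent (-1) + q) ltac:(lra).
  have [y [C hC]] := hex2 k; exists y, C => n.
  have := hC n; rewrite mulN1r => h1.
  rewrite -lerN2 opprD -mulrN; apply: le_trans h1.
  by rewrite lerD2r ler_wpM2l// lerBrDl -lerBrDr opprK ltW.
Qed.

End random_walk.

(** * Forward and inverse walks of circle diffeomorphisms *)

Section lyapunov.
Context {R : realType} {tau : R}.
Implicit Types (w : nat -> cdiff tau) (e : R).

Lemma fwd_walk w n : fwd w n = walk (fun k => dlift (w k)) n.
Proof. by elim: n => //= n ->. Qed.

Lemma bwd_rwalk w n : bwd w n = rwalk (fun k => dlift (w k)) n.
Proof. by elim: n => //= n ->. Qed.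

Lemma fwd_inv_walk w n : fwd_inv w n = walk (fun k => Defs.finv (dlift (w k))) n.
Proof. by elim: n => //= n ->. Qed.

Lemma bwd_inv_rwalk w n : bwd_inv w n = rwalk (fun k => Defs.finv (dlift (w k))) n.
Proof. by elim: n => //= n ->. Qed.

End lyapunov.

Lemma off_in_circle {R : realType} (x y : R) : in_circle x -> in_circle y ->
  `[< forall z : int, x <> y + z%:~R >] = (x != y).
Proof.
move=> /andP[x0 x1] /andP[y0 y1]; apply/asboolP/idP => [h|/eqP xy z E].
  by apply/eqP => E; apply: (h 0); rewrite addr0.
have [z0|z0|z0] := ltgtP z 0.
- have : z%:~R <= (-1 : R) by rewrite -(mulrN1z 1) ler_int -ltzD1 addNr.
  lra.
- have : (1 : R) <= z%:~R by rewrite ler1z.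
  lra.
- by apply: xy; rewrite E z0 addr0.
Qed.

(* [f_n^-1 ... f_1^-1] is inverse to [f_1 ... f_n], which has the same law as
   [f_n ... f_1]. *)
Lemma exponent_inverse {R : realType} (tau : R) (tau0 : 0 < tau)
    (nu : probability (Diff1t tau) R) (P : probability (DiffN tau) R) (e : R) :
  is_product_measure nu P ->
  exponent P (fun f => Defs.finv (dlift f)) e = exponent P (fun f => dlift f) (- e).
Proof.
move=> hP; have cd (f : Diff1t tau) := c1_lift_dlift tau0 f.
suff E n : mean_sup_walk P (fun f => Defs.finv (dlift f)) e n = mean_sup_walk P (fun f => dlift f) (- e) n.
  by rewrite /exponent (funext E).
suff I : (\int[P]_w (sup_logd e (walk (steps (fun f => Defs.finv (dlift f)) w) n))%:E =
    \int[P]_w (sup_logd (- e) (walk (steps (fun f => dlift f) w) n))%:E)%E.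
  exact: (congr1 fine I).
pose h (w : DiffN tau) := (sup_logd (- e) (walk (steps (fun f => dlift f) w) n))%:E.
have mh : measurable_fun setT h.
  apply/measurable_EFinP; apply: measurable_sup_walk => //.
  - exact: measurable_dlift.
  - exact: measurable_logd_dlift.
have h0 w : (0 <= h w)%E by rewrite lee_fin; apply: sup_walk_ge0.
transitivity (\int[P]_w h (prefix_rev n w))%E; last first.
  apply: (@ge0_integral_preserving _ _ _ _ _ P P (prefix_rev n) h _ _ mh h0).
    exact: measurable_prefix_rev.
  by move=> A mA; exact: (prefix_rev_preserving hP).
rewrite /h.
apply: eq_integral => w _; apply: (congr1 EFin).
rewrite (@sup_logd_inverse _ e (rwalk (fun k => dlift (w k)) n)).
- rewrite rwalk_rev; apply: (congr1 (sup_logd (- e))); apply: walk_ext => k kn.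
  by rewrite /steps /prefix_rev kn.
- by apply: c1_lift_rwalk => k; exact: cd.
- by apply: walkK => k; exact: finvK.
Qed.

Lemma ae_exists {R : realType} {d} {T : measurableType d} (P : probability T R) (Q : T -> Prop) :
  (\forall w \ae P, Q w) -> exists w, Q w.
Proof.
move=> [N [mN N0 hN]]; apply: contrapT => /forallNP h.
have NT : N = setT by apply/seteqP; split => // w _; apply: hN; exact: h.
by move: N0; rewrite NT probability_setT => -[] /eqP; rewrite oner_eq0.
Qed.

Theorem theorem1p3 (R : realType) (tau : R) (htau : 0 < tau)
  (nu : probability (Diff1t tau) R)
  (hsup : (\int[nu]_f (ln (supder (dlift f)))%:E < +oo)%E)
  (hinf : (-oo < \int[nu]_f (ln (infder (dlift f)))%:E)%E)
  (hprox : proximal (nu_support nu))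
  (hfix : fixes_no_point (nu_support nu))
  (P : probability (DiffN tau) R) (hP : is_product_measure nu P)
  (Lam lam : R)
  (hLam : {ae P, forall w : DiffN tau,
     (fun n : nat => n%:R^-1 * ln (supder (fwd w n))) @ \oo --> Lam})
  (hlam : {ae P, forall w : DiffN tau,
     (fun n : nat => n%:R^-1 * ln (infder (fwd w n))) @ \oo --> lam})
  (pi theta : DiffN tau -> R)
  (hpi_m : measurable_fun setT pi) (htheta_m : measurable_fun setT theta)
  (hpi_c : forall w, in_circle (pi w)) (htheta_c : forall w, in_circle (theta w))
  (hpi : forall x : R, in_circle x -> {ae P, forall w : DiffN tau,
     (fun n : nat => cdist (bwd w n x) (pi w)) @ \oo --> 0})
  (htheta : forall x : R, in_circle x -> {ae P, forall w : DiffN tau,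
     (fun n : nat => cdist (bwd_inv w n x) (theta w)) @ \oo --> 0}) :
  {ae P, forall w : DiffN tau, forall x : R, in_circle x ->
    ((fun n : nat => n%:R^-1 * ln `|derive1 (fwd_inv w n) x|) @ \oo -->
        (if x == pi w then - lam else - Lam)) /\
    ((fun n : nat => n%:R^-1 * ln `|derive1 (fwd w n) x|) @ \oo -->
        (if x == theta w then Lam else lam))}.
Proof.
have cd (f : Diff1t tau) := c1_lift_dlift htau f.
have ci (f : Diff1t tau) : c1_lift (Defs.finv (dlift f)) by exact: c1_lift_finv.
have dp : (\int[nu]_f (sup_logd 1 (dlift f))%:E < +oo)%E.
  by rewrite (eq_integral _ _ (fun f _ => congr1 EFin (ln_supder (cd f)))) in hsup.
(* [log inf] is nonpositive, so its integral is minus that of the nonnegative function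
   [sup_logd (-1)]. *)
have dm : (\int[nu]_f (sup_logd (-1) (dlift f))%:E < +oo)%E.
  move: hinf; rewrite (eq_integral _ _ (fun f _ => congr1 EFin (ln_infder (cd f)))).
  under eq_integral do rewrite EFinN.
  rewrite integral_ge0N; last by move=> f _; rewrite lee_fin; exact: sup_logd_ge0.
  by rewrite lteNr.
have ip : (\int[nu]_f (sup_logd 1 (Defs.finv (dlift f)))%:E < +oo)%E.
  by under eq_integral => f _ do rewrite sup_logd_finv//.
have im : (\int[nu]_f (sup_logd (-1) (Defs.finv (dlift f)))%:E < +oo)%E.
  have E (f : Diff1t tau) : sup_logd (-1) (Defs.finv (dlift f)) = sup_logd 1 (dlift f).
    by rewrite sup_logd_finv// opprK.
  rewrite (eq_integral _ _ (fun f _ => congr1 EFin (E f))); exact: dp.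
have hth x : in_circle x -> \forall w \ae P,
    (fun n => cdist (rwalk (fun k => Defs.finv (dlift (w k))) n x) (theta w)) @ \oo --> (0 : R).
  move=> hx; apply: (ae_imply (htheta x hx)) => w.
  rewrite (_ : (fun n => cdist (bwd_inv w n x) _) =
    (fun n => cdist (rwalk (fun k => Defs.finv (dlift (w k))) n x) (theta w)))//.
  by apply/funext => n; rewrite bwd_inv_rwalk.
have hpi' x : in_circle x -> \forall w \ae P,
    (fun n => cdist (rwalk (fun k => dlift (w k)) n x) (pi w)) @ \oo --> (0 : R).
  move=> hx; apply: (ae_imply (hpi x hx)) => w.
  rewrite (_ : (fun n => cdist (bwd w n x) _) =
    (fun n => cdist (rwalk (fun k => dlift (w k)) n x) (pi w)))//.
  by apply/funext => n; rewrite bwd_rwalk.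
have F := @walk_exponents _ _ nu P hP (fun f => dlift f) cd (measurable_dlift htau)
  (measurable_logd_dlift htau) dp dm (fun f => Defs.finv (dlift f)) ci
  (fun f => Kfinv (cd f)) (fun f => finvK (cd f)) theta hth.
have B := @walk_exponents _ _ nu P hP (fun f => Defs.finv (dlift f)) ci (measurable_finv_dlift htau)
  (measurable_logd_finv_dlift htau) ip im (fun f => dlift f) cd
  (fun f => finvK (cd f)) (fun f => Kfinv (cd f)) pi hpi'.
have cfwd (w : DiffN tau) n : c1_lift (fwd w n).
  by rewrite fwd_walk; apply: c1_lift_walk => k; exact: cd.
have Wp (w : DiffN tau) n : ln (supder (fwd w n)) = sup_logd 1 (walk (steps (fun f => dlift f) w) n).
  rewrite ln_supder; last exact: cfwd.
  rewrite fwd_walk; reflexivity.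
have Wm (w : DiffN tau) n : ln (infder (fwd w n)) = - sup_logd (-1) (walk (steps (fun f => dlift f) w) n).
  rewrite ln_infder; last exact: cfwd.
  rewrite fwd_walk; reflexivity.
(* [Lam] and [lam] are constants, so a single [w0] at which all these limits hold identifies them
   with the exponents. *)
have [w0 [[_ [Fp Fm]] [wL wl]]] := ae_exists (ae_and F (ae_and hLam hlam)).
have EL : exponent P (fun f => dlift f) 1 = Lam.
  apply: (cvg_unique _ Fp); first exact: norm_hausdorff.
  rewrite (funext (fun n => congr1 ( *%R n%:R^-1) (Wp w0 n))) in wL.
  exact: wL.
have El : - exponent P (fun f => dlift f) (-1) = lam.
  apply: (cvg_unique _ (cvgN Fm)); first exact: norm_hausdorff.
  rewrite (funext (fun n => etrans (congr1 ( *%R n%:R^-1) (Wm w0 n)) (mulrN _ _))) in wl.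
  exact: wl.
have IL : exponent P (fun f => Defs.finv (dlift f)) (-1) = Lam.
  by rewrite (exponent_inverse htau (-1) hP) opprK; exact: EL.
have Il : exponent P (fun f => Defs.finv (dlift f)) 1 = - lam.
  by rewrite (exponent_inverse htau 1 hP) -El opprK.
apply: (ae_imply (ae_and F B)) => w [[Fw _] [Bw _]] x hx; split.
  (* Off [pi w] the inverse walk has its lower exponent, [- Lam]; at [pi w] it has its upper one,
     [- lam]. *)
  have := Bw x; rewrite off_in_circle// IL Il.
  rewrite if_neg; apply: cvg_trans; apply: near_eq_cvg; apply: nearW => n.
  by rewrite fwd_inv_walk.
have := Fw x; rewrite off_in_circle// EL El if_neg.
apply: cvg_trans; apply: near_eq_cvg; apply: nearW => n.
by rewrite fwd_walk.
Qed.
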